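(* Let $K$ be a field and let $G$ be a threshold graph (without loops) on the vertex set $[m]=\{1,\dots,m\}$, and denote by $\lambda_i$ the degree of the vertex $i$. Order the vertices such that $\lambda_1\ge\lambda_2\ge\cdots\ge\lambda_m\ge 1$. Define $n:=\max\{i \mid \lambda_i\ge i+1\}$ and $\mu=(\mu_1,\dots,\mu_n):=(1,2,\dots,n)$, and let $\lambda=(\lambda_1,\dots,\lambda_n)$. Then the edge ideal of $G$ is $I_G=\overline{I}_{\lambda-\mu}$, and $\mathcal{F}_{\overline{X}_{\lambda-\mu}}$ is the minimal free cellular $\mathbb{Z}^m$-graded resolution of $I_G$. In particular, $\operatorname{reg}(I_G)=2$, $\operatorname{ht} I_G=n$, $\operatorname{depth} S/I_G=1$, and, for $i>0$, the $i$-th Betti number of $S/I_G$ over $S=K[x_1,\dots,x_m]$ is given by $$\beta_i(S/I_G)=\binom{\lambda_1-1}{i}+\binom{\lambda_2-1}{i}+\cdots+\binom{\lambda_n-1}{i}-\binom{n}{i+1}.$$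
   Context: A graph $G$ on $[m]$ (without loops) is a threshold graph if there is a vector $w=(w_1,\dots,w_m)\in\mathbb{R}^m$ such that, for $i\ne j$, $(i,j)$ is an edge of $G$ if and only if $w_i+w_j>0$. The edge ideal $I_G\subset S=K[x_1,\dots,x_m]$ is generated by the monomials $x_ix_j$ with $(i,j)$ an edge of $G$. $\operatorname{reg}$ is Castelnuovo–Mumford regularity, $\operatorname{ht}$ is height, and $\beta_i(S/I_G)$ is the rank of the $i$-th free module in the minimal free resolution of $S/I_G$. **Specialized generalized Ferrers ideals.** For integers $m\ge n$, a partition $\lambda=(\lambda_1,\dots,\lambda_n)$ with $m\ge\lambda_1\ge\cdots\ge\lambda_n\ge1$, and $\mu\in\mathbb{Z}^n$ with $0\le\mu_1\le\cdots\le\mu_n<\lambda_n$, the generalized Ferrers ideal is $I_{\lambda-\mu}:=(x_iy_j\mid 1\le i\le n,\ \mu_i<j\le\lambda_i)\subset K[x_1,\dots,x_n,y_1,\dots,y_m]$, and $\overline{I}_{\lambda-\mu}\subset S$ is its specialization under the substitution $x_i\mapsto x_i$, $y_j\mapsto x_j$, i.e. the ideal generated by the $x_ix_j$ with $1\le i\le n$, $\mu_i<j\le\lambda_i$. **Cellular complexes.** For a polyhedral cell complex $X$ (finite collection of polytopes closed under faces, any two meeting in a common face; the empty face is included) with an incidence function $\varepsilon$ (values $\pm1$ on pairs of a face and one of its facets, defining the cellular boundary map) and vertices labeled by monomials in $S$, each face $Q$ is labeled by the least common multiple $\mathbf{x}^{\mathbf{a}_Q}$ of its vertex labels (the empty face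 has label $1$). The cellular complex $\mathcal{F}_X$ is $$0\to S^{F_d(X)}\xrightarrow{\partial_d}\cdots\xrightarrow{\partial_1}S^{F_0(X)}\xrightarrow{\partial_0}S\to0,$$ where $d=\dim X$, $F_k(X)$ is the set of $k$-dimensional faces, $S^{F_k(X)}=\bigoplus_{P\in F_k(X)}S[-\mathbf{a}_P]$ has basis $\{e_P\}$, $\partial_k(e_P)=\sum_{Q\text{ facet of }P}\varepsilon(P,Q)\mathbf{x}^{\mathbf{a}_P-\mathbf{a}_Q}e_Q$, and $e_\emptyset=1$. If it is acyclic (exact except at the last term $S$), it is called a cellular resolution of the ideal $\operatorname{im}\partial_0$ generated by the vertex labels. **The complex $\overline{X}_{\lambda-\mu}$.** Let $X_{n,m}$ be the face complex of $\Delta_{n-1}\times\Delta_{m-1}$ (product of simplices with vertices labeled $x_1,\dots,x_n$ and $y_1,\dots,y_m$ respectively), with vertices labeled $x_iy_j$. $X_{\lambda-\mu}$ is the subcomplex of all faces all of whose vertices have labels in $I_{\lambda-\mu}$; $\overline{X}_{\lambda-\mu}$ is the same cell complex with each vertex label $x_iy_j$ replaced by $x_ix_j$.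
   Formalization: λ_i is taken to be the degree of vertex i plus one (closed neighbourhood) throughout, since with λ_i = degree the claim is false: for the triangle, λ=(2,2,2) gives n=1 and Ī=(x_1x_2), not I_G; the ordering and ≥1 conditions remain on the degrees. *)

(* Defs.v *)
From HB Require Import structures.
From mathcomp Require Import all_boot all_order all_algebra.
From mathcomp Require Import boolp reals.
From mathcomp Require Import mpoly.

Set Implicit Arguments.
Unset Strict Implicit.
Unset Printing Implicit Defensive.

Import Order.TTheory GRing.Theory Num.Theory.
Local Open Scope ring_scope.

(** * Ideals of a commutative ring *)

Definition ideal_gen (A : comNzRingType) (P : A -> Prop) : {pred A} :=
  [pred f | `[< exists (k : nat) (c g : 'I_k -> A),
                  (forall i, P (g i)) /\ f = \sum_(i < k) c i * g i >]].

(* [idealr_closed] includes properness. *)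
Definition prime_ideal (A : comNzRingType) (P : {pred A}) : Prop :=
  idealr_closed P /\ prime_idealr_closed P.

Definition psubset_ideal (A : comNzRingType) (I J : {pred A}) : Prop :=
  {subset I <= J} /\ ~ {subset J <= I}.

(* There is a chain C 0 < C 1 < ... < C h = P of prime ideals. *)
Definition prime_chain (A : comNzRingType) (P : {pred A}) (h : nat) : Prop :=
  exists C : nat -> {pred A},
    [/\ forall k, (k <= h)%N -> prime_ideal (C k),
        forall k, (k < h)%N -> psubset_ideal (C k) (C k.+1)
      & C h =i P].

Definition prime_height (A : comNzRingType) (P : {pred A}) (h : nat) : Prop :=
  prime_chain P h /\ forall h', prime_chain P h' -> (h' <= h)%N.

(* The minimum of the heights of the primes containing I. *)
Definition ideal_height (A : comNzRingType) (I : {pred A}) (h : nat) : Prop :=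
  (exists P : {pred A},
     [/\ prime_ideal P, {subset I <= P} & prime_height P h]) /\
  (forall (P : {pred A}) h', prime_ideal P -> {subset I <= P} ->
     prime_height P h' -> (h <= h')%N).

Definition ideal_add (A : comNzRingType) (I : {pred A}) (s : seq A) :
  {pred A} := ideal_gen (fun f => f \in I \/ f \in s).

(* s is a regular sequence on A / I. *)
Definition regular_seq (A : comNzRingType) (I : {pred A}) (s : seq A) : Prop :=
  (forall k f, (k < size s)%N ->
     s`_k * f \in ideal_add I (take k s) -> f \in ideal_add I (take k s)) /\
  1 \notin ideal_add I s.

(** * Graded free resolutions over S = K[x_1, ..., x_m] *)

Definition irrelevant_ideal (K : fieldType) (m : nat) : {pred {mpoly K[m]}} :=
  ideal_gen (fun f => exists i : 'I_m, f = 'X_i).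
Arguments irrelevant_ideal : clear implicits.

(* The depth of S / I with respect to (x_1, ..., x_m). *)
Definition quotient_depth (K : fieldType) (m : nat) (I : {pred {mpoly K[m]}})
    (d : nat) : Prop :=
  (exists s : seq {mpoly K[m]},
     [/\ size s = d, {subset s <= irrelevant_ideal K m} & regular_seq I s]) /\
  (forall s : seq {mpoly K[m]}, {subset s <= irrelevant_ideal K m} ->
     regular_seq I s -> (size s <= d)%N).

(* ... -> S^(rank 1) -> S^(rank 0) together with an augmentation to S.
   Elements of S^r are row vectors, so a map v |-> v *m D has the images of the
   basis vectors as the rows of D.  The a-th basis vector of the i-th module
   sits in degree [shift i a] of the grading group A. *)
Record free_complex (K : fieldType) (m : nat) (A : zmodType) := FreeComplex {
  rank : nat -> nat;
  shift : forall i, 'I_(rank i) -> A;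
  diff : forall i, 'M[{mpoly K[m]}]_(rank i.+1, rank i);
  aug : 'cV[{mpoly K[m]}]_(rank 0%N) }.

Definition std_degree (m : nat) (u : 'X_{1..m}) : int := (mdeg u)%:Z.

Definition multidegree (m : nat) (u : 'X_{1..m}) : 'rV[int]_m :=
  \row_j (u j)%:Z.

(* The maps are homogeneous of degree 0 when x^u has degree [gr u]. *)
Definition graded_complex (K : fieldType) (m : nat) (A : zmodType)
    (gr : 'X_{1..m} -> A) (F : free_complex K m A) : Prop :=
  (forall a u, u \in msupp (aug F a 0) -> shift a = gr u) /\
  (forall i (a : 'I_(rank F i.+1)) (b : 'I_(rank F i)) u,
     u \in msupp (diff F i a b) -> shift a = shift b + gr u).

(* F is a free resolution of the module J / I (with I contained in J):
   F_0 -> J / I is onto with kernel the image of F_1, and F is exact at F_i for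
   i > 0.  The pair (S, I) gives S / I, and (J, 0) the ideal J as a module. *)
Definition free_resolution (K : fieldType) (m : nat) (A : zmodType)
    (J I : {pred {mpoly K[m]}}) (F : free_complex K m A) : Prop :=
  [/\ forall f, f \in J <->
        exists (v : 'rV_(rank F 0)) g, g \in I /\ f = (v *m aug F) 0 0 + g,
      forall v : 'rV_(rank F 0), (v *m aug F) 0 0 \in I <->
        exists u, v = u *m diff F 0
    & forall i (v : 'rV_(rank F i.+1)), v *m diff F i = 0 <->
        exists u, v = u *m diff F i.+1].

Definition minimal_complex (K : fieldType) (m : nat) (A : zmodType)
    (F : free_complex K m A) : Prop :=
  forall i a b, diff F i a b \in irrelevant_ideal K m.

Definition min_graded_resolution (K : fieldType) (m : nat) (A : zmodType)
    (gr : 'X_{1..m} -> A) (J I : {pred {mpoly K[m]}})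
    (F : free_complex K m A) : Prop :=
  [/\ graded_complex gr F, free_resolution J I F & minimal_complex F].

Definition whole_ring (K : fieldType) (m : nat) : {pred {mpoly K[m]}} := predT.
Definition zero_ideal (K : fieldType) (m : nat) : {pred {mpoly K[m]}} := pred1 0.
Arguments whole_ring : clear implicits.
Arguments zero_ideal : clear implicits.

(* b is the i-th Betti number of S / I. *)
Definition quotient_betti (K : fieldType) (m : nat) (I : {pred {mpoly K[m]}})
    (i b : nat) : Prop :=
  (exists F : free_complex K m int,
     min_graded_resolution (@std_degree m) (whole_ring K m) I F) /\
  (forall F : free_complex K m int,
     min_graded_resolution (@std_degree m) (whole_ring K m) I F ->
     rank F i = b).

(* r is the Castelnuovo-Mumford regularity of the ideal I as a module: the
   largest d - i such that F_i has a generator of degree d. *)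
Definition ideal_regularity (K : fieldType) (m : nat) (I : {pred {mpoly K[m]}})
    (r : int) : Prop :=
  (exists F : free_complex K m int,
     min_graded_resolution (@std_degree m) I (zero_ideal K m) F) /\
  (forall F : free_complex K m int,
     min_graded_resolution (@std_degree m) I (zero_ideal K m) F ->
     (exists i (a : 'I_(rank F i)), shift a - i%:Z = r) /\
     (forall i (a : 'I_(rank F i)), shift a - i%:Z <= r)).

(** * Cell complexes and cellular complexes *)

(* A polyhedral cell complex is recorded by its face poset, the empty face
   included; [cdim1] is the dimension plus one, so it is 0 on the empty face and
   1 on vertices. *)
Record cell_complex := CellComplex {
  face : finType;
  empty_face : face;
  subface : rel face;
  cdim1 : face -> nat }.

Definition facet (X : cell_complex) (Q P : face X) : bool :=
  subface Q P && (cdim1 P == (cdim1 Q).+1).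

(* The last condition says that the cellular boundary map squares to zero. *)
Definition incidence_function (X : cell_complex)
    (eps : face X -> face X -> int) : Prop :=
  (forall P Q : face X, facet Q P -> eps P Q = 1 \/ eps P Q = -1) /\
  (forall P R : face X, subface R P -> cdim1 P = (cdim1 R).+2 ->
     \sum_(Q | facet Q P && facet R Q) eps P Q * eps Q R = 0).

(* Exponent of the least common multiple of the vertex labels of P. *)
Definition face_label (X : cell_complex) (m : nat)
    (label : face X -> 'X_{1..m}) (P : face X) : 'X_{1..m} :=
  \big[@mlcm m/0%MM]_(v | (cdim1 v == 1%N) && subface v P) label v.

(* Faces of dimension k. *)
Definition cells (X : cell_complex) (k : nat) : {set face X} :=
  [set P | cdim1 P == k.+1].

Definition cellular_coef (K : fieldType) (X : cell_complex) (m : nat)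
    (label : face X -> 'X_{1..m}) (eps : face X -> face X -> int)
    (P Q : face X) : {mpoly K[m]} :=
  if facet Q P
  then (eps P Q)%:~R * 'X_[(face_label label P - face_label label Q)%MM]
  else 0.
Arguments cellular_coef K {X m} label eps P Q.

(* [diff k] is the map S^(F_(k+1)) -> S^(F_k) of the cellular complex and [aug]
   is the map S^(F_0) -> S.  Only the values of [label] on vertices are used. *)
Definition cellular_complex (K : fieldType) (X : cell_complex) (m : nat)
    (label : face X -> 'X_{1..m}) (eps : face X -> face X -> int) :
    free_complex K m 'rV[int]_m :=
  @FreeComplex K m 'rV[int]_m
    (fun k => #|cells X k|)
    (fun k a => multidegree (face_label label (enum_val a)))
    (fun k => \matrix_(a < #|cells X k.+1|, b < #|cells X k|)
       cellular_coef K label eps (enum_val a) (enum_val b))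
    (\col_(a < #|cells X 0|)
       cellular_coef K label eps (enum_val a) (empty_face X)).
Arguments cellular_complex K {X m} label eps.

(** * Generalized Ferrers ideals and their specializations

   Indices are 0-based: the element i of 'I_n stands for i + 1, so that the
   condition mu_i < j <= lam_i reads [mu i < j.+1 <= lam i]; lam and mu keep
   their 1-based values. *)

Definition ferrers_shape (n m : nat) (lam mu : 'I_n -> nat) : Prop :=
  [/\ forall i, (lam i <= m)%N,
      forall i j : 'I_n, (i <= j)%N -> (lam j <= lam i)%N,
      forall i j : 'I_n, (i <= j)%N -> (mu i <= mu j)%N
    & forall i j : 'I_n, (mu i < lam j)%N].
Arguments ferrers_shape {n} m lam mu.

Definition in_shape (n m : nat) (lam mu : 'I_n -> nat) (i : 'I_n) (j : 'I_m) :
  bool := (mu i < j.+1 <= lam i)%N.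

(* The polynomial ring in x_1, ..., x_n, y_1, ..., y_m. *)
Definition gferrers_ideal (K : fieldType) (n m : nat) (lam mu : 'I_n -> nat) :
    {pred {mpoly K[n + m]}} :=
  ideal_gen (fun f => exists (i : 'I_n) (j : 'I_m),
    in_shape lam mu i j /\ f = 'X_(lshift m i) * 'X_(rshift n j)).
Arguments gferrers_ideal K {n m} lam mu.

Definition spec_gferrers_ideal (K : fieldType) (n m : nat) (le_nm : (n <= m)%N)
    (lam mu : 'I_n -> nat) : {pred {mpoly K[m]}} :=
  ideal_gen (fun f => exists (i : 'I_n) (j : 'I_m),
    in_shape lam mu i j /\ f = 'X_(widen_ord le_nm i) * 'X_j).
Arguments spec_gferrers_ideal K {n m} le_nm lam mu.

(* The nonempty faces of the product of the simplices on 'I_n and 'I_m are the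
   A x B with A, B nonempty; the pair (set0, set0) encodes the empty face. *)
Definition product_face (n m : nat) (P : {set 'I_n} * {set 'I_m}) : bool :=
  (P.1 == set0) == (P.2 == set0).

Definition gferrers_face (K : fieldType) (n m : nat) (lam mu : 'I_n -> nat)
    (P : {set 'I_n} * {set 'I_m}) : bool :=
  product_face P &&
  [forall i in P.1, forall j in P.2,
     ('X_(lshift m i) * 'X_(rshift n j) : {mpoly K[n + m]})
       \in gferrers_ideal K lam mu].
Arguments gferrers_face K {n m} lam mu P.

Definition gferrers_face_type (K : fieldType) (n m : nat)
    (lam mu : 'I_n -> nat) : finType :=
  {P : {set 'I_n} * {set 'I_m} | gferrers_face K lam mu P}.
Arguments gferrers_face_type K {n} m lam mu.

Lemma gferrers_face0 (K : fieldType) (n m : nat) (lam mu : 'I_n -> nat) :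
  gferrers_face K lam mu (set0, set0 : {set 'I_m}).
Proof.
rewrite /gferrers_face /product_face /= !eqxx /=.
by apply/forall_inP => i; rewrite inE.
Qed.

(* dim (A x B) + 1 = #|A| + #|B| - 1, where truncated subtraction gives 0 on the
   empty face. *)
Definition gferrers_complex (K : fieldType) (n m : nat)
    (lam mu : 'I_n -> nat) : cell_complex :=
  @CellComplex (gferrers_face_type K m lam mu)
    (exist _ (set0, set0) (gferrers_face0 K m lam mu))
    (fun Q P => ((val Q).1 \subset (val P).1) && ((val Q).2 \subset (val P).2))
    (fun P => (#|(val P).1| + #|(val P).2| - 1)%N).
Arguments gferrers_complex K {n} m lam mu.

(* On the vertex {i} x {j} this is the exponent of x_i x_j. *)
Definition spec_label (K : fieldType) (n m : nat) (le_nm : (n <= m)%N)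
    (lam mu : 'I_n -> nat) (v : face (gferrers_complex K m lam mu)) :
    'X_{1..m} :=
  ((\sum_(i in (val v).1) U_(widen_ord le_nm i)) +
   (\sum_(j in (val v).2) U_(j)))%MM.
Arguments spec_label K {n m} le_nm lam mu v.

(** * Threshold graphs *)

Definition threshold_graph (R : realType) (m : nat) (e : rel 'I_m) : Prop :=
  exists w : 'I_m -> R, forall i j : 'I_m, i != j -> e i j = (0 < w i + w j).
Arguments threshold_graph R {m} e.

Definition degree (m : nat) (e : rel 'I_m) (i : 'I_m) : nat :=
  #|[set j | e i j]|.

Definition edge_ideal (K : fieldType) (m : nat) (e : rel 'I_m) :
    {pred {mpoly K[m]}} :=
  ideal_gen (fun f => exists i j : 'I_m, e i j /\ f = 'X_i * 'X_j).
Arguments edge_ideal K {m} e.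

(* A neighbour set never contains the vertex itself, whereas row i of the
   Ferrers shape has to reach the last neighbour of vertex i; so the entries of
   the partition are the cardinalities of the closed neighbourhoods, i.e. the
   degrees plus one.  For instance, a single edge on two vertices has degrees
   (1, 1) and needs lam = (2, 2) in order that x_1 x_2 lies in the shape. *)
Definition graph_lambda (m : nat) (e : rel 'I_m) (i : 'I_m) : nat :=
  (degree e i).+1.

(* max {i | lam_i >= i + 1}, where the ordinal i stands for i + 1. *)
Definition durfee (m : nat) (lam : 'I_m -> nat) : nat :=
  (\max_(i < m | i.+1 + 1 <= lam i) i.+1)%N.

Lemma durfee_leq (m : nat) (lam : 'I_m -> nat) : (durfee lam <= m)%N.
Proof. by apply/bigmax_leqP => i _; apply: ltn_ord. Qed.

(* Main.v *)
Require Import Defs.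
From HB Require Import structures.
From mathcomp Require Import all_boot all_order all_algebra.
From mathcomp Require Import boolp reals.
From mathcomp Require Import zify ring mpoly.

(* Write A x B for a face of the complex, so that every a in A and b in B satisfy
   a < b < lam a (0-based indices); its label is the squarefree monomial on the
   disjoint union of A and B.  In a multidegree with support W, let c be the least
   element of W and let d be any element of W with c < d < lam c.  The faces with
   support in W are matched by toggling c in A, and then the remaining ones, which
   are the {c} x B and the empty face, by toggling d in B.  From upper to lower
   cells the boundary is triangular with entries +-1, whatever the incidence
   function, so the strand is exact.

   The resolution is minimal and linear.  A minimal graded resolution is unique up
   to homotopy, so it determines the regularity and the Betti numbers; the faces
   of given dimension are counted according to a = max A.

   The first n vertices cover all edges and the first n + 1 form a clique, so a
   prime containing I_G contains n variables.  Conversely, choosing one element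
   in each step of a chain of primes gives algebraically independent elements,
   which bounds the height of a prime generated by variables.  Finally, the sum of
   the variables is regular on S / I_G, and vertex 0, adjacent to all the others,
   prevents a regular sequence of length 2. *)

Set Implicit Arguments.
Unset Strict Implicit.
Unset Printing Implicit Defensive.

Import Order.TTheory GRing.Theory Num.Theory.
Local Open Scope ring_scope.

(** Both the incidence function and the minimal resolution are arbitrary in the statement, and this
    shapes the proof. For the cells, only the signs on facets and the vanishing of the squared
    boundary are available, so exactness comes from a matching whose triangularity refers only to
    which entries vanish; it holds in every characteristic. One toggle cannot match everything:
    removing c from {c} x B leaves no face, because a nonempty face needs a row. The second toggle
    takes care of these faces and pairs the vertex {c} x {d} with the empty face. For ranks and
    shifts no isomorphism of resolutions is constructed: modulo the variables a homotopy equivalence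
    becomes an identity f g = 1 over K, which is enough. These invariants also require one actual
    resolution, hence one actual incidence function. The simplicial sign rule on label supports
    provides it, since passing to a nonempty facet removes exactly one element of the support; only
    the step from a vertex to the empty face removes two and is treated apart. *)

(** * Ideals and their generators *)

Definition is_ideal (A : comNzRingType) (I : {pred A}) : Prop :=
  [/\ 0 \in I, {in I &, forall f g, f + g \in I}
    & forall a, {in I, forall f, a * f \in I}].

Section IsIdeal.
Variables (A : comNzRingType) (I : {pred A}).
Hypothesis idI : is_ideal I.

Lemma is_ideal_sum (T : Type) (r : seq T) (P : pred T) (F : T -> A) :
  (forall i, P i -> F i \in I) -> \sum_(i <- r | P i) F i \in I.
Proof. by case: idI => I0 ID _ FI; elim/big_rec: _ => // i f Pi fI; apply: ID => //; apply: FI. Qed.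

Lemma is_idealN f : f \in I -> - f \in I.
Proof. by case: idI => _ _ IM fI; rewrite -mulN1r IM. Qed.

Lemma is_idealB f g : f \in I -> g \in I -> f - g \in I.
Proof. by move=> fI gI; case: (idI) => _ ID _; apply: ID => //; apply: is_idealN. Qed.

Lemma is_idealMr a f : f \in I -> f * a \in I.
Proof. by case: idI => _ _ IM fI; rewrite mulrC IM. Qed.

Lemma is_idealD f g : f \in I -> g \in I -> f + g \in I.
Proof. by case: idI => _ ID _; apply: ID. Qed.

Lemma is_idealM a f : f \in I -> a * f \in I.
Proof. by case: idI => _ _ IM; apply: IM. Qed.
End IsIdeal.

Section IdealGen.
Variables (A : comNzRingType) (P : A -> Prop).

Lemma ideal_gen_sub (I : {pred A}) :
  is_ideal I -> (forall f, P f -> f \in I) -> {subset ideal_gen P <= I}.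
Proof.
move=> idI PI f /asboolP[k [c [g [gP ->]]]].
by apply: is_ideal_sum => // i _; apply: is_idealM => //; apply: PI.
Qed.

Lemma mem_ideal_gen f : P f -> f \in ideal_gen P.
Proof.
move=> Pf; apply/asboolP; exists 1%N, (fun=> 1), (fun=> f).
by split=> //; rewrite big_ord1 mul1r.
Qed.

Lemma is_ideal_gen : is_ideal (ideal_gen P).
Proof.
split.
- by apply/asboolP; exists 0%N, (fun=> 0), (fun=> 0); split=> [[]//|]; rewrite big_ord0.
- move=> f g /asboolP[k [c [u [uP ->]]]] /asboolP[l [d [v [vP ->]]]].
  apply/asboolP; exists (k + l)%N.
  exists (fun i => match split i with inl j => c j | inr j => d j end).
  exists (fun i => match split i with inl j => u j | inr j => v j end).
  split=> [i|]; first by case: (split i).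
  rewrite big_split_ord /=; congr (_ + _); apply: eq_bigr => i _.
    by rewrite -[lshift l i]/(unsplit (inl i)) unsplitK.
  by rewrite -[rshift k i]/(unsplit (inr i)) unsplitK.
- move=> a f /asboolP[k [c [u [uP ->]]]].
  apply/asboolP; exists k, (fun i => a * c i), u; split=> //.
  by rewrite mulr_sumr; apply: eq_bigr => i _; rewrite mulrA.
Qed.
End IdealGen.

Lemma eq_ideal_gen (A : comNzRingType) (P Q : A -> Prop) :
  (forall f, P f <-> Q f) -> ideal_gen P =i ideal_gen Q.
Proof.
move=> PQ f; apply/idP/idP; apply: ideal_gen_sub; try exact: is_ideal_gen;
  by move=> g /PQ; apply: mem_ideal_gen.
Qed.

(** * Monomial ideals and homogeneous parts *)

Section Polynomials.
Variables (K : fieldType) (m : nat).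
Local Notation S := {mpoly K[m]}.

(** The generators occur below as products of variables, so their exponents are passed separately as
    [G]. The condition on supports defines an ideal containing the generators; conversely it makes
    every term of f a multiple of a generator. *)
Lemma mem_monomial_ideal (P : S -> Prop) (G : 'X_{1..m} -> Prop) (f : S) :
    (forall g, P g <-> exists u, G u /\ g = 'X_[u]) ->
  f \in ideal_gen P <->
    (forall u, u \in msupp f -> exists g, G g /\ (g <= u)%MM).
Proof.
move=> PG; split.
  pose I := [pred f : S | `[< forall u, u \in msupp f -> exists g, G g /\ (g <= u)%MM >]].
  suff: f \in ideal_gen P -> f \in I by move=> + fP => /(_ fP)/asboolP.
  apply: ideal_gen_sub; last first.
    move=> _ /PG[u [Gu ->]]; apply/asboolP => v.
    by rewrite msuppX inE => /eqP->; exists u; split=> //; apply: lepm_refl.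
  split.
  - by apply/asboolP => u; rewrite msupp0.
  - move=> p q /asboolP pI /asboolP qI; apply/asboolP => u /msuppD_le.
    by rewrite mem_cat => /orP[/pI|/qI].
  - move=> a p /asboolP pI; apply/asboolP => u /msuppM_le /allpairsP.
    case=> -[u1 u2] /= [_ /pI[g [Gg le_g]] ->]; exists g; split=> //.
    by apply: lepm_trans le_g _; apply: lem_addl.
move=> suppf; rewrite [f]mpolyE big_seq.
apply: is_ideal_sum => [|u /suppf[g [Gg le_gu]]]; first exact: is_ideal_gen.
rewrite -(submK le_gu) mpolyXD -mul_mpolyC mulrA.
by apply: is_idealM; [apply: is_ideal_gen | apply/mem_ideal_gen/PG; exists g].
Qed.

Lemma is_ideal_irr : is_ideal (irrelevant_ideal K m).
Proof. exact: is_ideal_gen. Qed.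

Lemma irr_mcoeff0 f : f \in irrelevant_ideal K m -> f@_0%MM = 0.
Proof.
suff: {subset irrelevant_ideal K m <= [pred f : S | f@_0%MM == 0]}.
  by move=> sub /sub/eqP.
apply: ideal_gen_sub => [|_ [i ->]]; last first.
  by rewrite inE mcoeffX mnm1_eq0.
split=> [|p q|a p]; rewrite !inE ?mcoeff0 //.
  by move=> /eqP p0 /eqP q0; rewrite mcoeffD p0 q0 addr0.
by move=> /eqP p0; rewrite rmorphM /= p0 mulr0.
Qed.

(** The degree is an integer because it will be a difference of shifts, possibly negative; the part
    is then 0. *)
Definition degree_part (d : int) (p : S) : S :=
  \sum_(u <- msupp p | (mdeg u)%:Z == d) p@_u *: 'X_[u].

Lemma mcoeff_degree_part d p u :
  (degree_part d p)@_u = if (mdeg u)%:Z == d then p@_u else 0.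
Proof.
rewrite /degree_part raddf_sum /= big_mkcond /=.
have [up|uNp] := boolP (u \in msupp p); last first.
  rewrite big1_seq => [|v /= vp]; first by rewrite (memN_msupp_eq0 uNp); case: ifP.
  case: ifP => // _; rewrite mcoeffZ mcoeffX; case: eqP => [vu|]; last by rewrite mulr0.
  by rewrite -vu vp in uNp.
rewrite (bigD1_seq u) ?msupp_uniq //= big1 ?addr0 => [|v vu].
  by case: ifP => // _; rewrite mcoeffZ mcoeffX eqxx mulr1.
by case: ifP => // _; rewrite mcoeffZ mcoeffX (negPf vu) mulr0.
Qed.

Lemma degree_partD d p q : degree_part d (p + q) = degree_part d p + degree_part d q.
Proof.
apply/mpolyP => u; rewrite mcoeffD !mcoeff_degree_part mcoeffD.
by case: ifP; rewrite ?addr0.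
Qed.

Lemma degree_part0 d : degree_part d 0 = 0.
Proof. by rewrite /degree_part msupp0 big_nil. Qed.

Lemma degree_part_sum d (T : Type) (r : seq T) (F : T -> S) :
  degree_part d (\sum_(i <- r) F i) = \sum_(i <- r) degree_part d (F i).
Proof. exact: (big_morph _ (degree_partD d) (degree_part0 d)). Qed.

Lemma degree_partZ d c p : degree_part d (c *: p) = c *: degree_part d p.
Proof.
apply/mpolyP => u; rewrite mcoeffZ !mcoeff_degree_part mcoeffZ.
by case: ifP; rewrite ?mulr0.
Qed.

Lemma degree_part_homog d e p : {in msupp p, forall u, (mdeg u)%:Z = d} ->
  degree_part e p = if d == e then p else 0.
Proof.
move=> pd; apply/mpolyP => u; rewrite mcoeff_degree_part.
have [/pd->|/memN_msupp_eq0 pu] := boolP (u \in msupp p).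
  by case: ifP; rewrite ?mcoeff0.
by rewrite pu; do 2 case: ifP; rewrite ?mcoeff0.
Qed.

Lemma msupp_degree_part d p u : u \in msupp (degree_part d p) -> u \in msupp p /\ (mdeg u)%:Z = d.
Proof.
by rewrite !mcoeff_msupp mcoeff_degree_part; case: ifP => [/eqP->|]; rewrite ?eqxx.
Qed.

Lemma degree_partM d e p q : {in msupp q, forall u, (mdeg u)%:Z = e} ->
  degree_part (d + e) (p * q) = degree_part d p * q.
Proof.
move=> qe; elim/mpolyind: p => [|c u p _ _ IHp]; first by rewrite !(mul0r, degree_part0).
rewrite mulrDl !degree_partD mulrDl IHp; congr (_ + _).
rewrite -scalerAl !degree_partZ -scalerAl; congr (_ *: _).
rewrite (@degree_part_homog (mdeg u)%:Z d) => [|v]; last first.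
  by rewrite msuppX inE => /eqP->.
rewrite (@degree_part_homog ((mdeg u)%:Z + e)) => [|v /msuppM_le/allpairsP]; last first.
  by case=> -[u1 u2] /= []; rewrite msuppX inE => /eqP-> /qe <- ->; rewrite mdegD PoszD.
rewrite (inj_eq (addIr e)); case: ifP => //; by rewrite mul0r.
Qed.

End Polynomials.

(** * Minimal graded resolutions are unique *)

Section Uniqueness.
Variables (K : fieldType) (m : nat).
Local Notation S := {mpoly K[m]}.

Definition homog_mx r c (s : 'I_r -> int) (t : 'I_c -> int) (N : 'M[S]_(r, c)) :=
  forall a b u, u \in msupp (N a b) -> s a = t b + (mdeg u)%:Z.

Lemma homog_mxM r c d (s : 'I_r -> int) (t : 'I_c -> int) (q : 'I_d -> int) M N :
  homog_mx s t M -> homog_mx t q N -> homog_mx s q (M *m N).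
Proof.
move=> hM hN a b u; rewrite mxE => /msupp_sum_le/flatten_mapP[k _].
move=> /msuppM_le/allpairsP[[u1 u2] /= [/hM-> /hN-> ->]].
by rewrite mdegD PoszD -addrA [_%:Z + _]addrC.
Qed.

(** Multiplication by a homogeneous matrix commutes with taking parts of the appropriate degrees, so
    any lift of a homogeneous map can be replaced by a homogeneous lift. *)
Lemma homog_mx_degree_part r c d (s : 'I_r -> int) (t : 'I_c -> int) (q : 'I_d -> int)
    (f : 'M[S]_(r, c)) (D : 'M[S]_(c, d)) :
    homog_mx t q D ->
  let f' := \matrix_(a, b) degree_part (s a - t b) (f a b) in
  homog_mx s t f' /\ forall a b, (f' *m D) a b = degree_part (s a - q b) ((f *m D) a b).
Proof.
move=> hD f'; split=> [a b u|a b].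
  by rewrite mxE => /msupp_degree_part[_ ->]; rewrite addrC subrK.
rewrite !mxE degree_part_sum; apply: eq_bigr => k _; rewrite mxE.
have -> : s a - q b = (s a - t k) + (t k - q b) by rewrite addrA subrK.
by rewrite degree_partM // => u /hD->; rewrite addrC addKr.
Qed.

Lemma homog_mx_fix r d (s : 'I_r -> int) (q : 'I_d -> int) (N : 'M[S]_(r, d)) a b :
  homog_mx s q N -> degree_part (s a - q b) (N a b) = N a b.
Proof.
move=> hN; rewrite (@degree_part_homog _ _ (s a - q b)) ?eqxx // => u /hN->.
by rewrite addrC addKr.
Qed.

Lemma homog_mx_lift r c d (s : 'I_r -> int) (t : 'I_c -> int) (q : 'I_d -> int)
    (f : 'M[S]_(r, c)) (D : 'M[S]_(c, d)) :
    homog_mx t q D -> homog_mx s q (f *m D) ->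
  exists2 f' : 'M[S]_(r, c), f *m D = f' *m D & homog_mx s t f'.
Proof.
move=> hD hfD; have [hf' f'D] := homog_mx_degree_part s f hD.
by eexists; [apply/matrixP => a b; apply/esym/(etrans (f'D a b))/homog_mx_fix | exact: hf'].
Qed.

Lemma row_lift r c d (M : 'M[S]_(r, d)) (D : 'M[S]_(c, d)) :
  (forall u : 'rV_r, exists u', u *m M = u' *m D) -> exists N, M = N *m D.
Proof.
move=> h; have {h} h a : exists u', row a M = u' *m D.
  by rewrite rowE; apply: h.
have [N NP] := choice h; exists (\matrix_a N a).
by apply/row_matrixP => a; rewrite row_mul rowK NP.
Qed.

Variables (J I : {pred S}).
Hypotheses (idI : is_ideal I) (hI : forall d f, f \in I -> degree_part d f \in I).

(* f and g are mutually inverse up to homotopy, h and E being the two terms of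
   the homotopy; E, which comes from the previous step, has entries in the
   irrelevant ideal because the complexes are minimal. *)
Definition comparable_at (F G : free_complex K m int) i
    (f : 'M[S]_(rank F i, rank G i)) (g : 'M[S]_(rank G i, rank F i)) :=
  [/\ homog_mx (@shift _ _ _ F i) (@shift _ _ _ G i) f,
      exists N, diff F i *m f = N *m diff G i
    & exists h E, [/\ f *m g = 1%:M + h *m diff F i + E,
        diff F i *m E = 0 & forall a b, E a b \in irrelevant_ideal K m]].

(** [aug G] covers J modulo I, so [aug F] lifts through it up to an error in I. Passing to
    homogeneous parts keeps the error in I because I is homogeneous. *)
Lemma comparable_start (F G : free_complex K m int) :
    min_graded_resolution (@std_degree m) J I F ->
    min_graded_resolution (@std_degree m) J I G ->
  exists2 f : 'M[S]_(rank F 0, rank G 0), homog_mx (@shift _ _ _ F 0) (@shift _ _ _ G 0) f &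
    forall a, (aug F - f *m aug G) a 0 \in I.
Proof.
move=> [[augF _] [JF _ _] _] [[augG _] [JG _ _] _].
have h a : exists v : 'rV_(rank G 0), aug F a 0 - (v *m aug G) 0 0 \in I.
  have /JG[v [g [gI e]]] : aug F a 0 \in J.
    apply/JF; exists (delta_mx 0 a), 0; split; first by case: idI.
    by rewrite -rowE mxE addr0.
  by exists v; rewrite e addrC addKr.
have [f fP] := choice h; pose f1 := \matrix_a f a.
have hG : homog_mx (@shift _ _ _ G 0) (fun=> 0) (aug G).
  by move=> a b u; rewrite (ord1 b) add0r => /augG.
have hF : homog_mx (@shift _ _ _ F 0) (fun=> 0) (aug F).
  by move=> a b u; rewrite (ord1 b) add0r => /augF.
have [hf' f'G] := homog_mx_degree_part (@shift _ _ _ F 0) f1 hG.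
eexists; [exact: hf' | move=> a]; rewrite !mxE -[aug F a 0](homog_mx_fix _ _ hF).
have := f'G a 0; rewrite mxE => ->.
have -> p q d : degree_part d p - degree_part d q = degree_part d (p - q) :> S.
  by rewrite -scaleN1r -degree_partZ scaleN1r -degree_partD.
apply: hI; rewrite -[X in _ - X](_ : (f a *m aug G) 0 0 = _); first exact: fP.
by rewrite !mxE; apply: eq_bigr => k _; rewrite mxE.
Qed.

Lemma kernel_lift0 (F : free_complex K m int) r (M : 'M[S]_(r, rank F 0)) :
    free_resolution J I F -> (forall a, (M *m aug F) a 0 \in I) ->
  exists N, M = N *m diff F 0.
Proof.
move=> [_ FP _] MI; apply: row_lift => u; apply/FP.
rewrite -mulmxA mxE; apply: is_ideal_sum => // a _.
exact: is_idealM.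
Qed.

Lemma kernel_lift (F : free_complex K m int) i r (M : 'M[S]_(r, rank F i.+1)) :
    free_resolution J I F -> M *m diff F i = 0 ->
  exists N, M = N *m diff F i.+1.
Proof.
move=> [_ _ FP] M0; apply: row_lift => u; apply/FP.
by rewrite -mulmxA M0 mulmx0.
Qed.

Lemma diff_aug (F : free_complex K m int) a :
  free_resolution J I F -> (diff F 0 *m aug F) a 0 \in I.
Proof.
case=> _ FP _; have -> : (diff F 0 *m aug F) a 0 = (row a (diff F 0) *m aug F) 0 0.
  by rewrite -row_mul [RHS]mxE.
by apply/FP; exists (delta_mx 0 a); rewrite -rowE.
Qed.

Lemma diff_diff (F : free_complex K m int) i :
  free_resolution J I F -> diff F i.+1 *m diff F i = 0.
Proof.
case=> _ _ FP; apply/row_matrixP => a; rewrite row_mul row0.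
by apply/FP; exists (delta_mx 0 a); rewrite -rowE.
Qed.

Lemma mulmx_in_ideal r c d (M : 'M[S]_(r, c)) (N : 'M[S]_(c, d)) a b :
  (forall a, N a b \in I) -> (M *m N) a b \in I.
Proof. by move=> NI; rewrite mxE; apply: is_ideal_sum => // k _; apply: is_idealM. Qed.

Lemma comparable_base F G f g :
    min_graded_resolution (@std_degree m) J I F ->
    min_graded_resolution (@std_degree m) J I G ->
    homog_mx (@shift _ _ _ F 0) (@shift _ _ _ G 0) f ->
    (forall a, (aug F - f *m aug G) a 0 \in I) ->
    (forall a, (aug G - g *m aug F) a 0 \in I) ->
  comparable_at (i := 0) f g.
Proof.
move=> [_ resF _] [_ resG _] hf fP gP; split=> //.
- apply: kernel_lift0 resG _ => a; rewrite -mulmxA.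
  have -> : f *m aug G = aug F - (aug F - f *m aug G) by rewrite opprB addrC subrK.
  rewrite mulmxBr !mxE; apply: is_idealB => //.
    by have := diff_aug a resF; rewrite mxE.
  by apply: is_ideal_sum => // k _; apply: is_idealM.
- have [|h hE] := @kernel_lift0 F _ (f *m g - 1%:M) resF.
    move=> a; rewrite mulmxBl mul1mx -mulmxA.
    have -> : g *m aug F = aug G - (aug G - g *m aug F) by rewrite opprB addrC subrK.
    rewrite mulmxBr; set X := f *m (aug G - _).
    have -> : f *m aug G - X - aug F = - (X + (aug F - f *m aug G)).
      by rewrite opprD opprB addrA [- X + _]addrC.
    rewrite 2!mxE; apply: is_idealN => //; apply: is_idealD => //.
    exact: mulmx_in_ideal.
  exists h, 0; split; rewrite ?mulmx0 //.
    by rewrite addr0 -hE addrC subrK.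
  by move=> a b; rewrite mxE; case: (is_ideal_irr K m).
Qed.

(** Since [diff F i] kills E, it also kills [f' *m g' - 1 - diff F i *m h], which therefore lifts to
    the next homotopy term. The new E is [diff F i *m h], whose entries lie in the irrelevant ideal
    by minimality. *)
Lemma comparable_next F G i f g f' g' :
    min_graded_resolution (@std_degree m) J I F ->
    min_graded_resolution (@std_degree m) J I G ->
    comparable_at (i := i) f g ->
    homog_mx (@shift _ _ _ F i.+1) (@shift _ _ _ G i.+1) f' ->
    diff F i *m f = f' *m diff G i -> diff G i *m g = g' *m diff F i ->
  comparable_at (i := i.+1) f' g'.
Proof.
move=> [_ resF minF] [_ resG _] [_ _ [h [E [fg DE EI]]]] hf' f'P g'P; split=> //.
- apply: kernel_lift resG _.
  by rewrite -mulmxA -f'P mulmxA diff_diff // mul0mx.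
- have [|k kE] := @kernel_lift F i _ (f' *m g' - 1%:M - diff F i *m h) resF.
    rewrite !mulmxBl mul1mx -mulmxA -g'P mulmxA -f'P -!mulmxA fg !mulmxDr mulmx1 DE.
    by rewrite addr0 -addrA -opprD subrr.
  exists k, (diff F i *m h); split.
  + by rewrite -kE -addrA subrK addrC subrK.
  + by rewrite mulmxA diff_diff // mul0mx.
  + move=> a b; rewrite mxE; apply: is_ideal_sum => [|c _]; first exact: is_ideal_irr.
    by apply: is_idealMr; [apply: is_ideal_irr | apply: minF].
Qed.

Lemma comparable_all F G i :
    min_graded_resolution (@std_degree m) J I F ->
    min_graded_resolution (@std_degree m) J I G ->
  exists f g, comparable_at (F := F) (G := G) (i := i) f g
           /\ comparable_at (F := G) (G := F) (i := i) g f.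
Proof.
move=> resF resG; elim: i => [|i [f [g [fg gf]]]].
  have [f hf fP] := comparable_start resF resG.
  have [g hg gP] := comparable_start resG resF.
  by exists f, g; split; apply: comparable_base.
have lift F' G' (a : 'M_(rank F' i, rank G' i)) (b : 'M_(rank G' i, rank F' i)) :
    min_graded_resolution (@std_degree m) J I F' ->
    min_graded_resolution (@std_degree m) J I G' ->
    comparable_at a b -> exists2 a', diff F' i *m a = a' *m diff G' i &
      homog_mx (@shift _ _ _ F' i.+1) (@shift _ _ _ G' i.+1) a'.
  move=> [[_ hF'] _ _] [[_ hG'] _ _] [ha [N aN] _].
  have [N' NN' hN'] := homog_mx_lift (s := @shift _ _ _ F' i.+1) (f := N)
    (hG' i) (eq_ind _ (homog_mx _ _) (homog_mxM (hF' i) ha) _ aN).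
  by exists N' => //; rewrite aN.
have [f' f'P hf'] := lift _ _ _ _ resF resG fg.
have [g' g'P hg'] := lift _ _ _ _ resG resF gf.
by exists f', g'; split; apply: comparable_next; eassumption.
Qed.

(** Both homotopy terms have entries in the irrelevant ideal, so only the identity survives on
    constant terms. *)
Lemma comparable_const F G i f g : minimal_complex F ->
  comparable_at (F := F) (G := G) (i := i) f g ->
  map_mx (mcoeff 0%MM) f *m map_mx (mcoeff 0%MM) g = 1%:M.
Proof.
move=> minF [_ _ [h [E [fg _ EI]]]].
rewrite -map_mxM fg; apply/matrixP => a b; rewrite !mxE /= !mcoeffD.
rewrite (irr_mcoeff0 (EI a b)) addr0 raddf_sum /= [X in _ + X]big1 => [|k _].
  by rewrite addr0 mcoeffMn mcoeff1 eqxx.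
by rewrite rmorphM /= (irr_mcoeff0 (minF _ _ _)) mulr0.
Qed.

(** As f g = 1 on constant terms, row a of f contains an entry with nonzero constant term;
    homogeneity of that entry equates the two shifts. *)
Lemma min_resolution_shift F G i (a : 'I_(rank F i)) :
    min_graded_resolution (@std_degree m) J I F ->
    min_graded_resolution (@std_degree m) J I G ->
  exists b : 'I_(rank G i), shift a = shift b.
Proof.
move=> resF resG; have [f [g [fg _]]] := comparable_all i resF resG.
case: (resF) => _ _ minF; have := comparable_const minF fg.
move/matrixP/(_ a a); rewrite !mxE eqxx.
have [/existsP[b fab] _|/existsPn f0] := boolP [exists b, (f a b)@_0%MM != 0].
  case: fg => /(_ a b 0%MM) + _ _; rewrite mcoeff_msupp => /(_ fab).
  by rewrite mdeg0 addr0 => e; exists b.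
rewrite big1 => [/esym/eqP|b _]; first by rewrite oner_eq0.
by rewrite !mxE; have /negPn/eqP-> := f0 b; rewrite mul0r.
Qed.

Lemma min_resolution_rank_leq F G i :
    min_graded_resolution (@std_degree m) J I F ->
    min_graded_resolution (@std_degree m) J I G -> (rank F i <= rank G i)%N.
Proof.
move=> resF resG; have [f [g [fg _]]] := comparable_all i resF resG.
case: (resF) => _ _ minF; have := comparable_const minF fg.
by apply: mulmx1_min.
Qed.

Lemma min_resolution_rank F G i :
    min_graded_resolution (@std_degree m) J I F ->
    min_graded_resolution (@std_degree m) J I G -> rank F i = rank G i.
Proof. by move=> resF resG; apply/eqP; rewrite eqn_leq !min_resolution_rank_leq. Qed.

End Uniqueness.

(** * Chains of primes in a polynomial ring *)

Section Dimension.
Variables (K : fieldType) (m : nat).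
Local Notation S := {mpoly K[m]}.

Lemma prime_is_ideal (A : comNzRingType) (P : {pred A}) : prime_ideal P -> is_ideal P.
Proof.
case=> [[P0 _ PD] _]; split=> // [f g fP gP|a f fP].
  by rewrite -[f]mul1r PD.
by rewrite -[a * f]addr0 PD.
Qed.

Lemma prime_not1 (A : comNzRingType) (P : {pred A}) : prime_ideal P -> 1 \notin P.
Proof. by case=> [[_ P1 _] _]. Qed.

Lemma primeM (A : comNzRingType) (P : {pred A}) f g :
  prime_ideal P -> f * g \in P -> f \in P \/ g \in P.
Proof. by case=> _ /(_ f g) PM /PM/orP. Qed.

Definition degree_le (d : nat) (p : S) := {in msupp p, forall u, (mdeg u <= d)%N}.

Lemma degree_leM d e p q : degree_le d p -> degree_le e q -> degree_le (d + e) (p * q).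
Proof.
move=> pd qe u /msuppM_le/allpairsP[[u1 u2] /= [/pd le1 /qe le2 ->]].
by rewrite mdegD leq_add.
Qed.

Lemma degree_le1 : degree_le 0 1.
Proof. by move=> u; rewrite msupp1 inE => /eqP->; rewrite mdeg0. Qed.

Lemma degree_leW d e p : (d <= e)%N -> degree_le d p -> degree_le e p.
Proof. by move=> de pd u /pd/leq_trans; apply. Qed.

Lemma degree_leXn d p k : degree_le d p -> degree_le (k * d) (p ^+ k).
Proof.
move=> pd; elim: k => [|k IHk]; first by rewrite expr0 mul0n; apply: degree_le1.
by rewrite exprS mulSn; apply: degree_leM.
Qed.

Lemma degree_le_prod (I : finType) (F : I -> S) d :
  (forall i, degree_le d (F i)) -> degree_le (#|I| * d) (\prod_i F i).
Proof.
move=> Fd; rewrite -sum1_card big_distrl /=.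
elim/big_rec2: _ => [|i e p _ IHp]; first exact: degree_le1.
by rewrite mul1n; apply: degree_leM.
Qed.

Lemma mpoly_sum_msupp n (p : {mpoly K[n]}) (P : pred 'X_{1..n})
    (F : 'X_{1..n} -> 'X_{1..n}) v :
  v \in msupp (\sum_(u <- msupp p | P u) p@_u *: 'X_[F u]) ->
  exists u, [/\ u \in msupp p, P u & v = F u].
Proof.
move=> /msupp_sum_le/flatten_mapP[u]; rewrite mem_filter => /andP[Pu up].
by move=> /msuppZ_le; rewrite msuppX inE => /eqP->; exists u.
Qed.

(* There are t^N monomials in the y_i with exponents < t, lying in the space of
   polynomials of degree O(t), whose dimension is O(t^m). *)
Lemma algebraic_dependence N (y : N.-tuple S) : (m < N)%N ->
  exists2 p : {mpoly K[N]}, p != 0 & p \mPo y = 0.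
Proof.
move=> ltmN; pose D := \max_i msize (tnth y i).
have yD i : degree_le D (tnth y i).
  move=> u /msize_mdeg_lt/ltnW/leq_trans; apply.
  exact: (leq_bigmax (F := fun i => msize (tnth y i)) i).
(* A product of powers of the y_i with exponents < t has degree at most N t D < b, so b^m
   coefficients describe it. Since b <= (N D + 1) t and t > (N D + 1)^m, one gets b^m < t^(m+1) <=
   t^N. *)
pose t := ((N * D).+1 ^ m).+1; pose b := (N * (t * D)).+1.
pose rows := {ffun 'I_N -> 'I_t}; pose cols := {ffun 'I_m -> 'I_b}.
have lt_card : (#|{: cols}| < #|{: rows}|)%N.
  rewrite !card_ffun !card_ord.
  apply: (@leq_trans (t ^ m.+1)); last exact: leq_pexp2l.
  apply: (@leq_ltn_trans (((N * D).+1 * t) ^ m)).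
    have le_b : (b <= (N * D).+1 * t)%N.
      by rewrite /b [(t * D)%N]mulnC mulnA -add1n mulSn leq_add2r.
    by case: (posnP m) => [->|m_gt0]; rewrite ?expn0 ?leq_exp2r.
  by rewrite expnMn expnS ltn_pmul2r // expn_gt0.
pose mon (e : rows) : 'X_{1..N} := [multinom (e i : nat) | i < N].
pose M := \matrix_(i < #|{: rows}|, j < #|{: cols}|)
  ('X_[mon (enum_val i)] \mPo y)@_[multinom (enum_val j k : nat) | k < m].
have /rowV0Pn[c /sub_kermxP cM c0] : kermx M != 0.
  rewrite kermx_eq0; apply: contraTN lt_card => /eqP <-.
  by rewrite -leqNgt rank_leq_col.
pose p : {mpoly K[N]} := \sum_i c 0 i *: 'X_[mon (enum_val i)].
have pE i : p@_(mon (enum_val i)) = c 0 i.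
  rewrite raddf_sum (bigD1 i) //= big1 ?addr0 => [|j ji].
    by rewrite mcoeffZ mcoeffX eqxx mulr1.
  rewrite mcoeffZ mcoeffX; case: eqP => [e|]; last by rewrite mulr0.
  case/eqP: ji; apply/enum_val_inj/ffunP => k; apply/val_inj.
  by move/mnmP/(_ k): e; rewrite !mnmE.
exists p; first by apply: contraNneq c0 => p0; apply/eqP/rowP => i; rewrite mxE -pE p0 mcoeff0.
apply/mpolyP => u; rewrite mcoeff0.
have -> : p \mPo y = \sum_i ((c 0 i *: 'X_[mon (enum_val i)]) \mPo y).
  exact: (big_morph _ (comp_mpolyD y) (comp_mpoly0 y)).
rewrite raddf_sum /=.
have [lt_ub|le_bu] := boolP [forall k, u k < b]%N.
  pose w : cols := [ffun k => Ordinal (forallP lt_ub k)].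
  have := congr1 (fun A => fun_of_matrix A 0 (enum_rank w)) cM; rewrite !mxE => cw.
  apply: etrans cw.
  apply: eq_bigr => i _; rewrite mxE comp_mpolyZ mcoeffZ enum_rankK.
  by congr (_ * _@__); apply/mnmP => k; rewrite mnmE ffunE.
apply: big1 => i _; rewrite comp_mpolyZ mcoeffZ comp_mpolyX.
rewrite [X in _ * X]memN_msupp_eq0 ?mulr0 //.
apply: contra le_bu => uy; apply/forallP => k; rewrite ltnS.
apply: (@leq_trans (mdeg u)); first by rewrite mdegE (bigD1 k) //= leq_addr.
suff /(_ _ uy) : degree_le (#|'I_N| * (t * D)) (\prod_(j < N) tnth y j ^+ mon (enum_val i) j).
  by rewrite card_ord.
apply: degree_le_prod => j; apply: degree_leW (@degree_leXn _ _ (mon (enum_val i) j) (yD j)).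
by rewrite leq_mul2r mnmE ltnW ?orbT.
Qed.

(* If y_i lies in C (h - i) but not in C (h - i - 1), then y_0, ..., y_(k-1) are
   algebraically independent modulo C (h - k). *)
Lemma prime_chain_leq (P : {pred S}) h : prime_chain P h -> (h <= m)%N.
Proof.
case=> C [primeC ltC _]; rewrite leqNgt; apply/negP => ltmh.
have exy (i : 'I_h) : exists f, f \in C (h - i)%N /\ f \notin C (h - i.+1)%N.
  have lt_ih := ltn_ord i; have [_ nsub] := ltC (h - i.+1)%N (ltac:(lia)).
  apply: contrapT => nex; apply: nsub => f; rewrite subnSK // => fC.
  by apply: contrapT => /negP fN; apply: nex; exists f.
have [y yP] := choice exy; pose ty := [tuple y i | i < h].
have indep k (p : {mpoly K[h]}) : (k <= h)%N ->
    (forall u (i : 'I_h), u \in msupp p -> (k <= i)%N -> u i = 0%N) ->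
    p \mPo ty \in C (h - k)%N -> p = 0.
  elim: k p => [|k IHk] p lekh.
    move=> suppp; have -> : p = (p@_0%MM)%:MP.
      apply/mpolyP => u; rewrite mcoeffC; case: (u =P 0%MM) => [->|u0].
        by rewrite mulr1.
      rewrite mulr0; apply: memN_msupp_eq0; apply/negP => up; apply: u0.
      by apply/mnmP => i; rewrite mnm0E (suppp _ _ up).
    rewrite comp_mpolyC subn0 => cP; have [-> //|c0] := eqVneq p@_0%MM 0.
    have /negP[] := prime_not1 (primeC _ (leqnn h)).
    rewrite -(mpolyC1 m K) -(mulVf c0) mpolyCM.
    by apply: is_idealM => //; apply: prime_is_ideal; apply: primeC.
  have [d] := ubnP (msize p); elim: d p => // d IHd p ltpd suppp pC.
  have [//|pn0] := eqVneq p 0.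
  pose o := Ordinal lekh.
  (* Write p = p0 + p1 X_k with X_k absent from p0. As y_k lies in C (h - k), so does the value of
     p0, and the induction on k gives p0 = 0. Then y_k can be cancelled modulo the prime C (h - k -
     1), and the induction on the size handles p1. *)
  pose p0 := \sum_(u <- msupp p | u o == 0%N) p@_u *: 'X_[u] : {mpoly K[h]}.
  pose p1 := \sum_(u <- msupp p | u o != 0%N) p@_u *: 'X_[(u - U_(o))%MM] : {mpoly K[h]}.
  have pE : p = p0 + p1 * 'X_o.
    rewrite {1}[p]mpolyE (bigID (fun u : 'X_{1..h} => u o == 0%N)) /=; congr (_ + _).
    rewrite /p1 mulr_suml; apply: eq_bigr => u uo.
    by rewrite -scalerAl -mpolyXD submK ?lep1mP.
  have [yC yNC] := yP o.
  have tyo : 'X_o \mPo ty = y o by rewrite comp_mpolyXU -tnth_nth tnth_mktuple.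
  have idC j : (j <= h)%N -> is_ideal (C j) by move/primeC/prime_is_ideal.
  have p00 : p0 = 0.
    apply: IHk; first exact: ltnW.
      move=> u i /mpoly_sum_msupp[v [vp /eqP vo ->]] leki.
      have [->//|ltki] := eqVneq i o; apply: suppp vp _.
      by rewrite ltn_neqAle leki andbT eq_sym.
    have -> : p0 \mPo ty = p \mPo ty - (p1 \mPo ty) * y o.
      by rewrite pE comp_mpolyD rmorphM /= tyo addrK.
    have idk := idC (h - k)%N (leq_subr k h).
    apply: is_idealB (is_idealM idk _ yC) => //.
    have [|sub _] := ltC (h - k.+1)%N; first by lia.
    by rewrite subnSK // in sub; apply: sub.
  have p10 : p1 = 0.
    apply: IHd.
    - apply: leq_ltn_trans (_ : (msize p).-1 < d)%N => [|]; last first.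
        by move: ltpd; rewrite (mpolySpred _ pn0).
      rewrite msizeE; apply/bigmax_leqP_seq => u /mpoly_sum_msupp[v [vp vo ->]] _.
      have : (U_(o) <= v)%MM by rewrite lep1mP.
      move/submK => e; have := msize_mdeg_lt vp; rewrite -{1}e mdegD mdeg1 addn1.
      by case: (msize p).
    - move=> u i /mpoly_sum_msupp[v [vp vo ->]] leki.
      by rewrite mnmBE (suppp _ _ vp).
    - have: (p1 \mPo ty) * y o \in C (h - k.+1)%N.
        by move: pC; rewrite pE p00 add0r rmorphM /= tyo.
      by case/primeM => [|//|]; [apply: primeC; lia | rewrite (negPf yNC)].
  by rewrite pE p00 p10 mul0r addr0.
have [p p0 py] := algebraic_dependence ty ltmh.
case/eqP: p0; apply: (indep h) => //.
  by move=> u i _; rewrite leqNgt ltn_ord.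
by rewrite py subnn; case: (prime_is_ideal (primeC 0%N (leq0n h))).
Qed.

Lemma prime_chain_rcons (P Q : {pred S}) h :
  prime_chain P h -> prime_ideal Q -> psubset_ideal P Q -> prime_chain Q h.+1.
Proof.
move=> [C [primeC ltC CP]] primeQ [PQ nPQ].
exists (fun k => if (k <= h)%N then C k else Q); split.
- by move=> k _; case: ifP => // /primeC.
- move=> k; rewrite ltnS => lekh; rewrite lekh; case: ifP => [|/negbT]; first exact: ltC.
  rewrite -ltnNge ltnS => lehk; have -> : k = h by apply/eqP; rewrite eqn_leq lekh.
  by split=> [f|sub]; [rewrite CP; apply: PQ | apply: nPQ => f /sub; rewrite CP].
- by rewrite ltnn.
Qed.

(** * Prime ideals generated by variables *)

Definition zeroing (A : {set 'I_m}) (f : S) : S :=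
  f \mPo [tuple if i \in A then 0 else 'X_i | i < m].

Definition hits (A : {set 'I_m}) (u : 'X_{1..m}) := [exists i in A, u i != 0%N].

Lemma mcoeff_zeroing A f u : (zeroing A f)@_u = if hits A u then 0 else f@_u.
Proof.
rewrite /zeroing; elim/mpolyind: f => [|c v p _ _ IHp].
  by rewrite comp_mpoly0 mcoeff0; case: ifP.
rewrite comp_mpolyD comp_mpolyZ !mcoeffD !mcoeffZ IHp comp_mpolyX.
have -> : \prod_(i < m) tnth [tuple if i \in A then 0 else 'X_i | i < m] i ^+ v i
    = if hits A v then 0 else 'X_[v] :> S.
  case: ifPn => [/existsP[i /andP[iA vi]]|/existsPn hv].
    by rewrite (bigD1 i) //= tnth_mktuple iA expr0n (negPf vi) mul0r.
  rewrite mpolyXE_id; apply: eq_bigr => i _; rewrite tnth_mktuple.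
  by have := hv i; case: ifP => //= _ /negPn/eqP->; rewrite !expr0.
case: (ifP (hits A v)) => hv.
  rewrite mcoeff0 mulr0 add0r mcoeffX; case: ifP => // hu.
  by case: eqP hu => [<-|]; rewrite ?hv // mulr0 add0r.
rewrite mcoeffX; case: ifP => // hu.
by case: eqP hu => [<-|]; rewrite ?hv // mulr0 add0r.
Qed.

(** The ideal generated by the variables in A, taken as the kernel of a ring endomorphism of a
    domain so that it is visibly prime. *)
Definition var_prime (A : {set 'I_m}) : {pred S} := [pred f | zeroing A f == 0].

Lemma var_primeP A f :
  reflect (forall u, u \in msupp f -> hits A u) (f \in var_prime A).
Proof.
apply: (iffP eqP) => [f0 u|suppf].
  rewrite mcoeff_msupp; apply: contraNT => /negPf hu.
  by have := mcoeff_zeroing A f u; rewrite f0 hu mcoeff0 => ->.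
apply/mpolyP => u; rewrite mcoeff_zeroing mcoeff0; case: ifPn => // hu.
by apply: memN_msupp_eq0; apply: contra hu; apply: suppf.
Qed.

Lemma var_primeX A i : ('X_i \in var_prime A) = (i \in A).
Proof.
apply/var_primeP/idP => [/(_ U_(i)%MM)|iA u].
  rewrite msuppX inE eqxx => /(_ isT)/existsP[j /andP[jA]].
  by rewrite mnm1E; case: (i =P j) => // ->.
rewrite msuppX inE => /eqP->; apply/existsP; exists i.
by rewrite iA mnm1E eqxx.
Qed.

Lemma prime_var_prime A : prime_ideal (var_prime A).
Proof.
split; first split.
- by rewrite inE /zeroing comp_mpoly0.
- by rewrite inE /zeroing comp_mpoly1 oner_eq0.
- move=> a f g; rewrite !inE /zeroing comp_mpolyD rmorphM => /= /eqP-> /eqP->.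
  by rewrite mulr0 addr0.
- by move=> f g; rewrite !inE /zeroing rmorphM /= mulf_eq0.
Qed.

Lemma var_primeS (A B : {set 'I_m}) : A \subset B -> {subset var_prime A <= var_prime B}.
Proof.
move=> /subsetP AB f /var_primeP fA; apply/var_primeP => u /fA/existsP[i /andP[iA ui]].
by apply/existsP; exists i; rewrite AB.
Qed.

Lemma var_prime_min (A : {set 'I_m}) (P : {pred S}) :
  is_ideal P -> {in A, forall i, 'X_i \in P} -> {subset var_prime A <= P}.
Proof.
move=> idP AP f /var_primeP fA; rewrite [f]mpolyE big_seq.
apply: is_ideal_sum => // u /fA/existsP[i /andP[iA]]; rewrite -lep1mP => iu.
rewrite -(submK iu) mpolyXD -mul_mpolyC mulrA.
by apply: is_idealM => //; apply: AP.
Qed.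

Lemma prime_chain_setU1 (A : {set 'I_m}) i h : i \notin A ->
  prime_chain (var_prime A) h -> prime_chain (var_prime (i |: A)) h.+1.
Proof.
move=> iA chA; apply: prime_chain_rcons chA _ _; first exact: prime_var_prime.
split; first by apply: var_primeS; apply: subsetUr.
by move=> /(_ 'X_i); rewrite !var_primeX setU11 (negPf iA) => /(_ isT).
Qed.

Lemma prime_chain_var (A B : {set 'I_m}) h : A \subset B ->
  prime_chain (var_prime A) h -> prime_chain (var_prime B) (h + #|B :\: A|).
Proof.
have [k] := ubnP #|B :\: A|; elim: k A h => // k IHk A h ltk AB chA.
have [BA|[i iBA]] := set_0Vmem (B :\: A).
  have -> : B = A by apply/eqP; rewrite eqEsubset AB andbT -setD_eq0 BA.
  by rewrite setDv cards0 addn0.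
have /setDP[iB iA] := iBA.
have -> : (h + #|B :\: A| = h.+1 + #|B :\: (i |: A)|)%N.
  by rewrite (cardsD1 i) iBA setDDl setUC addnA addn1.
apply: IHk => //; last exact: prime_chain_setU1.
  by move: ltk; rewrite (cardsD1 i (B :\: A)) iBA setDDl setUC.
by rewrite subUset sub1set iB.
Qed.

Lemma prime_chain_var_card A : prime_chain (var_prime A) #|A|.
Proof.
have := @prime_chain_var set0 A 0; rewrite setD0; apply; first exact: sub0set.
exists (fun=> var_prime set0); split=> // k _; exact: prime_var_prime.
Qed.

(** A chain ending at this prime extends by one step for each variable outside A, and the extended
    chain has length at most m. *)
Lemma prime_height_var A : prime_height (var_prime A) #|A|.
Proof.
split=> [|h chA]; first exact: prime_chain_var_card.
have /prime_chain_leq := prime_chain_var (subsetT A) chA.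
by rewrite setTD -[X in (_ <= X)%N](card_ord m) -(cardsC A) leq_add2r.
Qed.

(** P contains the prime generated by the variables in A. If the inclusion is strict, P prolongs a
    chain of length #|A|; otherwise it ends that very chain. *)
Lemma prime_height_geq (P : {pred S}) (A : {set 'I_m}) h :
  prime_ideal P -> {in A, forall i, 'X_i \in P} -> prime_height P h -> (#|A| <= h)%N.
Proof.
move=> primeP AP [_ maxh]; have chA := prime_chain_var_card A.
have subAP := var_prime_min (prime_is_ideal primeP) AP.
have [subPA|nsub] := EM {subset P <= var_prime A}; last first.
  by apply: ltnW; apply: maxh; apply: prime_chain_rcons chA primeP _.
apply: maxh; case: chA => C [primeC ltC CA]; exists C; split=> // f.
by rewrite CA; apply/idP/idP => [/subAP|/subPA].
Qed.

End Dimension.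

(** * Acyclic matchings *)

(* V is the set of cells of a subcomplex, partitioned by [up] into pairs of a
   lower cell (of kind L1 or L2) and an upper one; from upper to lower cells the
   boundary is triangular. *)
Section Matching.
Variables (T : finType) (K : fieldType) (d : T -> T -> K).
Variables (V L1 L2 : pred T) (up : T -> T).
Hypothesis dd0 : forall P R, \sum_Q d P Q * d Q R = 0.
Hypothesis dV : forall P Q, d P Q != 0 -> V P -> V Q.
Let L Q := L1 Q || L2 Q.
Hypothesis upV : forall Q, V Q -> L Q -> V (up Q).
Hypothesis up_neq0 : forall Q, V Q -> L Q -> d (up Q) Q != 0.
Hypothesis up1 : forall Q Q', V Q -> V Q' -> L1 Q -> L1 Q' -> d (up Q) Q' != 0 -> Q = Q'.
Hypothesis up2 : forall Q Q', V Q -> V Q' -> L2 Q -> L2 Q' -> d (up Q) Q' != 0 -> Q = Q'.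
Hypothesis up21 : forall Q Q', V Q -> V Q' -> L2 Q -> L1 Q' -> d (up Q) Q' = 0.
Hypothesis up_onto : forall P, V P -> ~~ L P -> exists Q, [/\ V Q, L Q & P = up Q].

Definition boundary (w : T -> K) (Q : T) := \sum_P w P * d P Q.

Lemma boundaryB w1 w2 Q : boundary (fun P => w1 P - w2 P) Q = boundary w1 Q - boundary w2 Q.
Proof. by rewrite -sumrB; apply: eq_bigr => P _; rewrite mulrBl. Qed.

Lemma boundary_bnd w Q : boundary (boundary w) Q = 0.
Proof.
transitivity (\sum_P \sum_R w R * (d R P * d P Q)).
  by apply: eq_bigr => P _; rewrite mulr_suml; apply: eq_bigr => R _; rewrite mulrA.
by rewrite exchange_big big1 // => R _; rewrite -mulr_sumr dd0 mulr0.
Qed.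

Lemma boundary_supp w Q : (forall P, w P != 0 -> V P) -> boundary w Q != 0 -> V Q.
Proof.
move=> wV; apply: contraNT => nVQ; rewrite /boundary big1 // => P _.
have [->|wP] := eqVneq (w P) 0; first by rewrite mul0r.
have [->|dPQ] := eqVneq (d P Q) 0; first by rewrite mulr0.
by rewrite (dV dPQ (wV _ wP)) in nVQ.
Qed.

(** Within one kind the matrix [d (up Q) Q'] is diagonal with nonzero diagonal, so coefficients on
    the upper cells are found by division. The last clause will ensure that clearing one kind does
    not spoil the other. *)
Lemma matching_clear (v : T -> K) (Lk : pred T) :
    (forall Q, Lk Q -> L Q) ->
    (forall Q Q', V Q -> V Q' -> Lk Q -> Lk Q' -> d (up Q) Q' != 0 -> Q = Q') ->
    (forall P, v P != 0 -> V P) ->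
  exists w, [/\ forall P, w P != 0 -> V P, forall Q, Lk Q -> v Q = boundary w Q &
    forall Q', V Q' -> (forall Q, V Q -> Lk Q -> d (up Q) Q' = 0) -> boundary w Q' = 0].
Proof.
move=> LkL upk vV.
pose x Q := if V Q && Lk Q then v Q / d (up Q) Q else 0.
pose w P := \sum_(Q | up Q == P) x Q.
have wE Q' : boundary w Q' = \sum_Q x Q * d (up Q) Q'.
  rewrite [RHS](partition_big up predT) //=; apply: eq_bigr => P _.
  by rewrite mulr_suml; apply: eq_bigr => Q /eqP->.
have wV P : w P != 0 -> V P.
  apply: contraNT => nVP; rewrite /w big1 // => Q /eqP upQ.
  rewrite /x; case: ifP => // /andP[VQ LkQ].
  by rewrite -upQ upV ?LkL in nVP.
exists w; split=> // [Q' LQ'|Q' VQ' dQ'].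
- have [VQ'|nVQ'] := boolP (V Q'); last first.
    transitivity (0 : K); first by apply/eqP; apply: contraNT nVQ' => /vV.
    by apply/esym/eqP; apply: contraNT nVQ' => /(boundary_supp wV).
  rewrite wE (bigD1 Q') //= big1 ?addr0 => [|Q QQ'].
    by rewrite /x VQ' LQ' mulfVK // up_neq0 // LkL.
  rewrite /x; case: ifP => [/andP[VQ LQ]|]; last by rewrite mul0r.
  have [->|/upk e] := eqVneq (d (up Q) Q') 0; first by rewrite mulr0.
  by rewrite e ?eqxx in QQ'.
- rewrite wE big1 // => Q _; rewrite /x; case: ifP => [/andP[VQ LQ]|]; last by rewrite mul0r.
  by rewrite dQ' ?mulr0.
Qed.

(** [up21] dictates the order: clearing L2 after L1 leaves L1 cleared. What remains is a cycle
    supported on upper cells; reading its boundary at the lower cells, again L1 before L2, shows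
    that it is 0. *)
Lemma matching_exact v : (forall P, v P != 0 -> V P) -> (forall Q, boundary v Q = 0) ->
  exists w, (forall P, w P != 0 -> V P) /\ forall Q, v Q = boundary w Q.
Proof.
move=> vV v0.
have [w1 [w1V w1L _]] := @matching_clear v L1 (fun Q h => introT orP (or_introl h)) up1 vV.
pose v1 Q := v Q - boundary w1 Q.
have subV (f g : T -> K) P : (forall P, f P != 0 -> V P) -> (forall P, g P != 0 -> V P) ->
    f P - g P != 0 -> V P.
  move=> fV gV; have [->|/fV //] := eqVneq (f P) 0.
  by rewrite sub0r oppr_eq0; apply: gV.
have v1V P : v1 P != 0 -> V P by apply: subV => // Q; apply: boundary_supp.
have [w2 [w2V w2L w2N]] := @matching_clear v1 L2 (fun Q h => introT orP (or_intror h)) up2 v1V.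
pose v2 Q := v1 Q - boundary w2 Q.
have v2V P : v2 P != 0 -> V P by apply: subV => // Q; apply: boundary_supp.
have v20 Q : boundary v2 Q = 0 by rewrite !boundaryB !boundary_bnd v0 !subr0.
have v2L1 Q : L1 Q -> v2 Q = 0.
  move=> L1Q; have [VQ|] := boolP (V Q); last by apply: contraNeq => /v2V.
  by rewrite /v2 /v1 w1L // subrr w2N ?subr0 // => Q' VQ' L2Q'; apply: up21.
have v2L2 Q : L2 Q -> v2 Q = 0 by move=> L2Q; rewrite /v2 w2L // subrr.
(* When no other upper cell contributes at Q, the cycle condition there reads v2 (up Q) * d (up Q) Q
   = 0. *)
have v2up Q : V Q -> L Q -> (forall Q', V Q' -> L Q' -> Q' != Q -> v2 (up Q') * d (up Q') Q = 0) ->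
    v2 (up Q) = 0.
  move=> VQ LQ other; have := v20 Q; rewrite /boundary (bigD1 (up Q)) //= big1 ?addr0.
    by move/eqP; rewrite mulf_eq0 (negPf (up_neq0 VQ LQ)) orbF => /eqP.
  move=> P PQ; have [->|v2P] := eqVneq (v2 P) 0; first by rewrite mul0r.
  have [|Q' [VQ' LQ' PE]] := up_onto (v2V _ v2P).
    by apply: contra v2P => /orP[/v2L1->|/v2L2->].
  by rewrite PE other //; apply: contraNneq PQ => <-; rewrite PE.
have v2up1 Q : V Q -> L1 Q -> v2 (up Q) = 0.
  move=> VQ L1Q; apply: v2up => //; first by rewrite /L L1Q.
  move=> Q' VQ' /orP[L1Q'|L2Q'] Q'Q; last by rewrite up21 ?mulr0.
  have [->|/up1 e] := eqVneq (d (up Q') Q) 0; first by rewrite mulr0.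
  by rewrite e ?eqxx in Q'Q.
have v2up2 Q : V Q -> L2 Q -> v2 (up Q) = 0.
  move=> VQ L2Q; apply: v2up => //; first by rewrite /L L2Q orbT.
  move=> Q' VQ' /orP[L1Q'|L2Q'] Q'Q; first by rewrite v2up1 ?mul0r.
  have [->|/up2 e] := eqVneq (d (up Q') Q) 0; first by rewrite mulr0.
  by rewrite e ?eqxx in Q'Q.
have v2_0 P : v2 P = 0.
  apply/eqP; apply/negP => /negP v2P.
  have [|Q [VQ /orP[L1Q|L2Q] PE]] := up_onto (v2V _ v2P).
  - by apply: contra v2P => /orP[/v2L1->|/v2L2->].
  - by rewrite PE v2up1 ?eqxx in v2P.
  - by rewrite PE v2up2 ?eqxx in v2P.
exists (fun P => w1 P + w2 P); split=> [P|Q].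
  by have [->|/w1V //] := eqVneq (w1 P) 0; rewrite add0r; apply: w2V.
have /eqP := v2_0 Q; rewrite /v2 /v1 subr_eq0 subr_eq => /eqP->.
by rewrite addrC -big_split; apply: eq_bigr => P _; rewrite mulrDl.
Qed.

End Matching.

(** * Faces of the complex *)

(** The x and y variables are distinct, so a generator dividing x_i y_j is x_i y_j itself. Ideal
    membership of vertex labels thus becomes a condition on indices. *)
Lemma gferrers_faceE (K : fieldType) n m (lam mu : 'I_n -> nat)
    (P : {set 'I_n} * {set 'I_m}) :
  gferrers_face K lam mu P =
    product_face P && [forall i in P.1, forall j in P.2, in_shape lam mu i j].
Proof.
congr (_ && _); apply: eq_forallb_in => i _; apply: eq_forallb_in => j _.
pose mon (i : 'I_n) (j : 'I_m) : 'X_{1..n + m} := (U_(lshift m i) + U_(rshift n j))%MM.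
apply/idP/idP => [|ij]; last by apply: mem_ideal_gen; exists i, j.
have PG (f : {mpoly K[n + m]}) : (exists i j, in_shape lam mu i j /\
      f = 'X_(lshift m i) * 'X_(rshift n j)) <->
    exists u, (exists i j, in_shape lam mu i j /\ u = mon i j) /\ f = 'X_[u].
  split=> [[i' [j' [ij ->]]]|[_ [[i' [j' [ij ->]]] ->]]].
    by exists (mon i' j'); rewrite mpolyXD; split=> //; exists i', j'.
  by exists i', j'; rewrite mpolyXD.
move=> /(mem_monomial_ideal _ PG)/(_ (mon i j)).
rewrite -mpolyXD msuppX inE eqxx => /(_ isT)[_ [[i' [j' [ij ->]]] /mnm_lepP le]].
have := le (lshift m i'); rewrite !mnmDE !mnm1E eqxx.
rewrite !(eq_sym (rshift _ _)) !eq_lrshift (inj_eq (@lshift_inj _ _)).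
have := le (rshift n j'); rewrite !mnmDE !mnm1E eqxx !eq_lrshift (inj_eq (@rshift_inj _ _)).
by case: (i =P i') => // ->; case: (j =P j') => // ->.
Qed.

Lemma addn_eq_leq a b c d : (a <= c)%N -> (b <= d)%N -> (c + d = a + b)%N ->
  a = c /\ b = d.
Proof. lia. Qed.

Section Cells.
Variables (K : fieldType) (n m : nat) (le_nm : (n <= m)%N) (lam : 'I_n -> nat).
Hypothesis lam_mono : forall i j : 'I_n, (i <= j)%N -> (lam j <= lam i)%N.

Local Notation mu := (fun i : 'I_n => i.+1).
Local Notation X := (gferrers_complex K m lam mu).
Local Notation w := (widen_ord le_nm).

Definition rows (P : face X) : {set 'I_n} := (val P).1.
Definition cols (P : face X) : {set 'I_m} := (val P).2.

Lemma face_inj (P Q : face X) : rows P = rows Q -> cols P = cols Q -> P = Q.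
Proof.
rewrite /rows /cols => eqr eqc; apply: val_inj.
by case: (val P) (val Q) eqr eqc => [A B] [A' B'] /= -> ->.
Qed.

(** With mu i = i + 1 the shape condition [mu a < b.+1 <= lam a] unfolds to these inequalities. They
    separate rows from columns, although both index the same variables after specialization. *)
Lemma face_mem (P : face X) a b : a \in rows P -> b \in cols P -> (a < b < lam a)%N.
Proof.
rewrite /rows /cols => aP bP; have := valP P; rewrite /= gferrers_faceE.
by case/andP=> _ /forall_inP/(_ _ aP)/forall_inP/(_ _ bP).
Qed.

Lemma rows_eq0 (P : face X) : (rows P == set0) = (cols P == set0).
Proof. by have := valP P; rewrite /= gferrers_faceE => /andP[/eqP]. Qed.

Lemma rows_empty : rows (empty_face X) = set0. Proof. by []. Qed.
Lemma cols_empty : cols (empty_face X) = set0. Proof. by []. Qed.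

Lemma empty_faceP (P : face X) : reflect (P = empty_face X) (rows P == set0).
Proof.
apply: (iffP eqP) => [r0|->]; last by rewrite rows_empty.
by apply: face_inj; rewrite ?rows_empty ?cols_empty //; apply/eqP; rewrite -rows_eq0 r0.
Qed.

Lemma cdim1E (P : face X) : cdim1 P = (#|rows P| + #|cols P|).-1.
Proof. by rewrite -subn1. Qed.

Lemma cdim1_nonempty (P : face X) : rows P != set0 ->
  (cdim1 P).+1 = (#|rows P| + #|cols P|)%N.
Proof. by rewrite cdim1E -card_gt0; case: #|rows P|. Qed.

Lemma cdim1_eq0 (P : face X) : (cdim1 P == 0%N) = (rows P == set0).
Proof.
have [/empty_faceP->|r0] := boolP (rows P == set0).
  by rewrite cdim1E rows_empty cols_empty !cards0.
have c0 : (0 < #|cols P|)%N by rewrite card_gt0 -rows_eq0.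
have := cdim1_nonempty r0; rewrite -card_gt0 in r0.
by case: (cdim1 P) => // e; have := leq_add r0 c0; rewrite -e.
Qed.

Lemma cdim1_empty : cdim1 (empty_face X) = 0%N.
Proof. by apply/eqP; rewrite cdim1_eq0 rows_empty. Qed.

Lemma vertexP (P : face X) : cdim1 P = 1%N ->
  exists a b, rows P = [set a] /\ cols P = [set b].
Proof.
move=> dimP; have r0 : rows P != set0 by rewrite -cdim1_eq0 dimP.
have := cdim1_nonempty r0; rewrite dimP => card2.
have c0 : cols P != set0 by rewrite -rows_eq0.
move: r0 c0; rewrite -!card_gt0 => r0 c0.
have /cards1P[a Pa] : #|rows P| == 1%N.
  by rewrite eqn_leq r0 andbT -(leq_add2r #|cols P|) -card2 add1n ltnS.
have /cards1P[b Pb] : #|cols P| == 1%N.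
  by move: card2; rewrite Pa cards1 add1n => -[<-].
by exists a, b.
Qed.

Lemma subfaceE (Q P : face X) :
  subface Q P = (rows Q \subset rows P) && (cols Q \subset cols P).
Proof. by []. Qed.

(** A pair that is not a face is sent to the empty face, so [gfaceP] has to be invoked before its
    rows and columns can be read off. *)
Definition gface (A : {set 'I_n}) (B : {set 'I_m}) : face X :=
  insubd (empty_face X) (A, B).

Lemma gfaceP (A : {set 'I_n}) (B : {set 'I_m}) : A != set0 -> B != set0 ->
    (forall a b, a \in A -> b \in B -> (a < b < lam a)%N) ->
  rows (gface A B) = A /\ cols (gface A B) = B.
Proof.
move=> A0 B0 AB; rewrite /rows /cols val_insubd ifT //= gferrers_faceE.
rewrite /product_face (negPf A0) (negPf B0) /=.
by apply/forall_inP => a aA; apply/forall_inP => b bB; apply: AB.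
Qed.

Definition fsupp (P : face X) : {set 'I_m} := w @: rows P :|: cols P.

Lemma widen_inj : injective w.
Proof. by move=> i j /(congr1 val) /= /val_inj. Qed.

Lemma fsupp_disjoint (P : face X) a : a \in rows P -> w a \notin cols P.
Proof.
by move=> aP; apply/negP => aP'; have := face_mem aP aP'; rewrite ltnn.
Qed.

Lemma card_fsupp (P : face X) : #|fsupp P| = (#|rows P| + #|cols P|)%N.
Proof.
rewrite cardsU card_imset; last exact: widen_inj.
rewrite [X in (_ - X)%N](_ : _ = 0%N) ?subn0 //.
apply/eqP; rewrite cards_eq0 setI_eq0; apply/pred0P => k /=; apply/negP => /andP[].
by case/imsetP=> a aP ->; apply/negP/fsupp_disjoint.
Qed.

Lemma fsuppS (Q P : face X) : subface Q P -> fsupp Q \subset fsupp P.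
Proof. by rewrite subfaceE => /andP[sr sc]; rewrite setUSS ?imsetS. Qed.

Lemma spec_labelE (P : face X) : spec_label K le_nm lam mu P = mesym1 (fsupp P).
Proof.
apply/mnmP => k; rewrite /spec_label mnmDE !mnm_sumE mnmE -/(rows P) -/(cols P).
have -> : \sum_(i in cols P) U_(i)%MM k = (k \in cols P).
  have [kP|kNP] := boolP (k \in cols P).
    rewrite (bigD1 k) //= mnm1E eqxx big1 ?addn0 // => i /andP[_ ik].
    by rewrite mnm1E (negPf ik).
  by rewrite big1 // => i iP; rewrite mnm1E; case: eqP iP => // ->; rewrite (negPf kNP).
rewrite in_setU; have [/imsetP[a aP ->]|kNr] := boolP (k \in w @: rows P).
  rewrite (negPf (fsupp_disjoint aP)) addn0 (bigD1 a) //= mnm1E eqxx big1 // => i /andP[_ ia].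
  by rewrite mnm1E (inj_eq widen_inj) (negPf ia).
rewrite big1 // => i iP; rewrite mnm1E; case: eqP => // wi.
by rewrite -wi imset_f in kNr.
Qed.

Lemma mlcm_bigE (I : finType) (P : pred I) (G : I -> 'X_{1..m}) k :
  (\big[@mlcm m/0%MM]_(i | P i) G i) k = \max_(i | P i) G i k.
Proof.
elim/big_rec2: _ => [|i u v _ <-]; first by rewrite mnm0E.
by rewrite /mlcm mnmE.
Qed.

(** Vertices of P have their support inside that of P. Conversely, an element of the support is the
    row or the column of some vertex {a} x {b} of P, because a face with a row has a column and vice
    versa. *)
Lemma face_labelE (P : face X) :
  face_label (spec_label K le_nm lam mu) P = mesym1 (fsupp P).
Proof.
apply/mnmP => k; rewrite mlcm_bigE mnmE; apply/eqP; rewrite eqn_leq; apply/andP; split.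
  apply/bigmax_leqP => v /andP[_ /fsuppS/subsetP vP]; rewrite spec_labelE mnmE.
  by case: (boolP (k \in fsupp v)) => // /vP->.
have [kP|//] := boolP (k \in fsupp P).
have [a [b [aP bP kab]]] : exists a b, [/\ a \in rows P, b \in cols P & (k == w a) || (k == b)].
  have r0 : rows P != set0.
    case/setUP: kP => [/imsetP[a aP _]|kP]; last rewrite rows_eq0; apply/set0Pn;
      by [exists a | exists k].
  have [b bP] : exists b, b \in cols P by apply/set0Pn; rewrite -rows_eq0.
  have [a aP] := set0Pn _ r0.
  case/setUP: kP => [/imsetP[a' aP' ->]|kP].
    by exists a', b; rewrite eqxx.
  by exists a, k; rewrite eqxx orbT.
have [|||rv cv] := @gfaceP [set a] [set b].
- by apply/set0Pn; exists a; rewrite set11.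
- by apply/set0Pn; exists b; rewrite set11.
- by move=> a' b' /set1P-> /set1P->; apply: face_mem aP bP.
apply: (@leq_trans (spec_label K le_nm lam mu (gface [set a] [set b]) k)).
  by rewrite spec_labelE mnmE /fsupp rv cv imset_set1 !inE kab.
apply: (leq_bigmax_cond (F := fun v => spec_label K le_nm lam mu v k)).
by rewrite cdim1E subfaceE rv cv !cards1 !sub1set aP bP.
Qed.

Lemma mesym1_leP (A : {set 'I_m}) (u : 'X_{1..m}) :
  reflect {in A, forall i, u i != 0%N} (mesym1 A <= u)%MM.
Proof.
apply: (iffP mnm_lepP) => [le i iA|Au i].
  by have := le i; rewrite mnmE iA lt0n.
by rewrite mnmE; case: (boolP (i \in A)) => // /Au; rewrite lt0n.
Qed.

Lemma mesym1_le (A B : {set 'I_m}) : A \subset B -> (mesym1 A <= mesym1 B)%MM.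
Proof. by move/subsetP=> AB; apply/mesym1_leP => i /AB iB; rewrite mnmE iB. Qed.

(** * Exactness of the strand in one multidegree *)

Section Exactness.
Variable eps : face X -> face X -> int.
Hypothesis incP : incidence_function eps.

Definition inc (P Q : face X) : K := if facet Q P then (eps P Q)%:~R else 0.

Lemma inc_neq0 P Q : (inc P Q != 0) = facet Q P.
Proof.
rewrite /inc; case: ifP => [QP|]; last by rewrite eqxx.
have [epsP _] := incP; have [->|->] := epsP _ _ QP.
  by rewrite oner_eq0.
by rewrite mulrNz oppr_eq0 oner_eq0.
Qed.

Lemma inc_comp P R : \sum_Q inc P Q * inc Q R = 0.
Proof.
have [/andP[RP /eqP dimP]|no] := boolP (subface R P && (cdim1 P == (cdim1 R).+2)).
  have [_ /(_ _ _ RP dimP)/(congr1 (fun z : int => z%:~R : K))] := incP.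
  rewrite raddf_sum /= big_mkcond => sum0; rewrite -[RHS]sum0.
  apply: eq_bigr => Q _; rewrite /inc; case: ifP => /= _; last by rewrite mul0r.
  by case: ifP; rewrite ?mulr0 // rmorphM.
rewrite big1 // => Q _; have [->|] := eqVneq (inc P Q) 0; first by rewrite mul0r.
have [->|] := eqVneq (inc Q R) 0; first by rewrite mulr0.
rewrite !inc_neq0 => /andP[RQ /eqP dimQ] /andP[QP /eqP dimP].
case/negP: no; rewrite dimP dimQ eqxx andbT.
move: RQ QP; rewrite !subfaceE => /andP[r1 c1] /andP[r2 c2].
by rewrite (subset_trans r1) // (subset_trans c1).
Qed.

Lemma inc_supp P Q : inc P Q != 0 -> fsupp Q \subset fsupp P.
Proof. by rewrite inc_neq0 => /andP[/fsuppS]. Qed.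

Section Strand.
Variables (W : {set 'I_m}) (c : 'I_n) (d : 'I_m).
Hypotheses (cW : w c \in W) (dW : d \in W) (cd : (c < d < lam c)%N).
Hypothesis c_min : forall a, w a \in W -> (c <= a)%N.

Let V (P : face X) := fsupp P \subset W.
Let L1 (P : face X) := (c \notin rows P) && (rows P != set0).
Let L2 (P : face X) := (rows P \subset [set c]) && (d \notin cols P).
(** In the second kind the rows are set to {c} outright, rather than kept, because P may be the
    empty face, whose partner is the vertex {c} x {d}. *)
Let up (P : face X) := if rows P \subset [set c] then gface [set c] (d |: cols P)
                       else gface (c |: rows P) (cols P).

Lemma fsupp_subP (P : face X) :
  V P = [forall a in rows P, w a \in W] && (cols P \subset W).
Proof.
rewrite /V subUset; congr (_ && _).
apply/subsetP/forall_inP => [PW a aP|PW _ /imsetP[a aP ->]]; last exact: PW.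
by apply: PW; rewrite imset_f.
Qed.

Lemma L1_sub P : L1 P -> rows P \subset [set c] = false.
Proof.
case/andP=> cP /set0Pn[a aP]; apply: contraNF cP => /subsetP/(_ a aP)/set1P <-.
exact: aP.
Qed.

(** Adding c yields a face: for a row a' and a column b of P, minimality of c and monotonicity of
    [lam] give c <= a' < b < lam a' <= lam c. *)
Lemma up_L1 P : V P -> L1 P -> rows (up P) = c |: rows P /\ cols (up P) = cols P.
Proof.
move=> VP L1P; rewrite /up (L1_sub L1P); have /andP[cP r0] := L1P.
apply: gfaceP => [||a b]; last first.
- rewrite in_setU1 => /orP[/eqP->|aP] bP; last exact: face_mem aP bP.
  have [a' aP'] := set0Pn _ r0; have /andP[lt_ab lt_b] := face_mem aP' bP.
  move: VP; rewrite fsupp_subP => /andP[/forall_inP/(_ _ aP')/c_min le_ca _].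
  by rewrite (leq_ltn_trans le_ca) // (leq_trans lt_b) // lam_mono.
- by rewrite -rows_eq0.
- by apply/set0Pn; exists c; rewrite setU11.
Qed.

Lemma up_L2 P : V P -> L2 P -> rows (up P) = [set c] /\ cols (up P) = d |: cols P.
Proof.
move=> VP /andP[Pc dP]; rewrite /up Pc; apply: gfaceP => [||a b /set1P->].
- by apply/set0Pn; exists c; rewrite set11.
- by apply/set0Pn; exists d; rewrite setU11.
- rewrite in_setU1 => /orP[/eqP->//|bP]; have : rows P != set0.
    by rewrite rows_eq0; apply/set0Pn; exists b.
  move=> /set0Pn[a' aP]; have /set1P aE := subsetP Pc _ aP.
  by rewrite -{1 2}aE (face_mem aP bP).
Qed.

Lemma L2_rows P : L2 P -> rows P = if cols P == set0 then set0 else [set c].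
Proof.
case/andP=> Pc _; case: ifP => [|/negbT]; first by rewrite -rows_eq0 => /eqP.
by rewrite -rows_eq0; move: Pc; rewrite subset1 => /orP[/eqP->//|->].
Qed.

(** One formula covers both {c} x B and the empty face, where truncated subtraction gives 0. *)
Lemma L2_cdim1 P : L2 P -> cdim1 P = #|cols P|.
Proof.
move=> L2P; rewrite cdim1E (L2_rows L2P).
by case: eqP => [->|_]; rewrite ?cards0 // cards1.
Qed.

Lemma up_cdim1_L2 P : V P -> L2 P -> cdim1 (up P) = #|cols P|.+1.
Proof.
move=> VP L2P; have [r_up c_up] := up_L2 VP L2P; have /andP[_ dP] := L2P.
by rewrite cdim1E r_up c_up cards1 cardsU1 dP.
Qed.

Lemma strand_exact (v : face X -> K) :
    (forall P, v P != 0 -> V P) -> (forall Q, \sum_P v P * inc P Q = 0) ->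
  exists w, (forall P, w P != 0 -> V P) /\ forall Q, v Q = \sum_P w P * inc P Q.
Proof.
apply: (@matching_exact _ _ inc V L1 L2 up).
- exact: inc_comp.
- by move=> P Q /inc_supp QP; apply: subset_trans.
- move=> Q VQ; have := VQ; rewrite !fsupp_subP => /andP[/forall_inP rW cW'].
  case/orP=> LQ.
    have [-> ->] := up_L1 VQ LQ; rewrite cW' andbT.
    by apply/forall_inP => a; rewrite in_setU1 => /orP[/eqP->|/rW].
  have [-> ->] := up_L2 VQ LQ; rewrite subUset sub1set dW cW' /= andbT.
  by apply/forall_inP => a /set1P->.
- move=> Q VQ; rewrite inc_neq0 /facet subfaceE => /orP[] LQ.
    have [r_up c_up] := up_L1 VQ LQ; have /andP[cQ r0] := LQ.
    rewrite r_up c_up subsetUr subxx /= -eqSS cdim1_nonempty; last first.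
      by rewrite r_up; apply/set0Pn; exists c; rewrite setU11.
    by rewrite r_up c_up cardsU1 cQ cdim1_nonempty.
  rewrite up_cdim1_L2 // L2_cdim1 // eqxx andbT.
  have [-> ->] := up_L2 VQ LQ; rewrite subsetUr andbT.
  by have /andP[] := LQ.
(* A facet Q' of [up Q] avoiding c already lies in Q, and the equality of dimensions forces Q' = Q.
   The next case is the same with d in place of c. *)
- move=> Q Q' VQ VQ' LQ LQ'; rewrite inc_neq0 /facet subfaceE -eqSS.
  have [r_up c_up] := up_L1 VQ LQ.
  have /andP[cQ r0] := LQ; have /andP[cQ' r0'] := LQ'.
  rewrite (cdim1_nonempty r0') cdim1_nonempty; last first.
    by rewrite r_up; apply/set0Pn; exists c; rewrite setU11.
  rewrite r_up c_up cardsU1 cQ => /andP[/andP[sr sc] /eqP card_eq].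
  have {}sr : rows Q' \subset rows Q.
    apply/subsetP => a aQ'; have := subsetP sr _ aQ'; rewrite in_setU1.
    by case: eqP aQ' => // ->; rewrite (negPf cQ').
  have leR := subset_leq_card sr; have leC := subset_leq_card sc.
  have [eqr eqc] := addn_eq_leq leR leC (succn_inj card_eq).
  apply: face_inj; apply/esym/eqP.
    by rewrite eqEcard sr eqr leqnn.
  by rewrite eqEcard sc eqc leqnn.
- move=> Q Q' VQ VQ' LQ LQ'; rewrite inc_neq0 /facet subfaceE.
  rewrite up_cdim1_L2 // L2_cdim1 // eqSS; have [-> ->] := up_L2 VQ LQ.
  case/andP=> /andP[_ sc] /eqP card_eq; have /andP[_ dQ'] := LQ'.
  have {}sc : cols Q' \subset cols Q.
    apply/subsetP => b bQ'; have := subsetP sc _ bQ'; rewrite in_setU1.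
    by case: eqP bQ' => // ->; rewrite (negPf dQ').
  have eqc : cols Q = cols Q' by apply/esym/eqP; rewrite eqEcard sc card_eq leqnn.
  by apply: face_inj => //; rewrite !L2_rows // eqc.
- move=> Q Q' VQ VQ' LQ LQ'; apply/eqP; apply: contraT.
  rewrite inc_neq0 /facet subfaceE => /andP[/andP[]].
  by have [-> _] := up_L2 VQ LQ; rewrite L1_sub.
- move=> P VP; rewrite negb_or; have := VP; rewrite fsupp_subP => /andP[/forall_inP rW cW'].
  have [Pc|Pc] := boolP (rows P \subset [set c]); last first.
    rewrite /L1 /L2 (negPf Pc) /=.
    have r0 : rows P != set0 by apply: contraNneq Pc => ->; apply: sub0set.
    rewrite r0 !andbT negbK => cP.
    have [||| rQ cQ] := @gfaceP (rows P :\ c) (cols P).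
    + by move: Pc; rewrite -setD_eq0.
    + by rewrite -rows_eq0.
    + by move=> a b /setD1P[_ aP]; apply: face_mem.
    have LQ : L1 (gface (rows P :\ c) (cols P)).
      by rewrite /L1 rQ setD11 /=; move: Pc; rewrite -setD_eq0.
    have VQ : V (gface (rows P :\ c) (cols P)).
      rewrite fsupp_subP rQ cQ cW' andbT.
      by apply/forall_inP => a /setD1P[_ /rW].
    exists (gface (rows P :\ c) (cols P)); split=> //; first by apply/orP; left.
    have [r_up c_up] := up_L1 VQ LQ.
    by apply: face_inj; rewrite ?r_up ?c_up ?rQ ?cQ // setD1K.
  rewrite /L2 Pc negbK => /andP[_ dP].
  have rP : rows P = [set c].
    move: Pc; rewrite subset1 => /orP[/eqP//|]; rewrite rows_eq0 => /eqP c0.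
    by rewrite c0 inE in dP.
  (* If d is the only column, removing it leaves no face with row c; the partner of P is then the
     empty face. *)
  have [d_only|d_more] := eqVneq (cols P :\ d) set0.
    have L2e : L2 (empty_face X) by rewrite /L2 rows_empty cols_empty sub0set inE.
    have Ve : V (empty_face X).
      rewrite fsupp_subP rows_empty cols_empty sub0set andbT.
      by apply/forall_inP => a; rewrite inE.
    exists (empty_face X); split=> //; first by apply/orP; right.
    have [r_up c_up] := up_L2 Ve L2e.
    by apply: face_inj; rewrite ?r_up ?c_up ?rP // cols_empty -d_only setD1K.
  have [||| rQ cQ] := @gfaceP [set c] (cols P :\ d).
  + by apply/set0Pn; exists c; rewrite set11.
  + by [].
  + by move=> a b /set1P-> /setD1P[_ bP]; apply: face_mem bP; rewrite rP set11.
  have LQ : L2 (gface [set c] (cols P :\ d)).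
    by rewrite /L2 rQ cQ subxx setD11.
  have VQ : V (gface [set c] (cols P :\ d)).
    rewrite fsupp_subP rQ cQ; apply/andP; split.
      by apply/forall_inP => a /set1P->.
    by apply: subset_trans cW'; apply: subsetDl.
  exists (gface [set c] (cols P :\ d)); split=> //; first by apply/orP; right.
  have [r_up c_up] := up_L2 VQ LQ.
  by apply: face_inj; rewrite ?r_up ?c_up ?rP ?cQ // setD1K.
Qed.

End Strand.
End Exactness.
End Cells.

(** * The cellular resolution *)

Section Resolution.
Variables (K : fieldType) (n m : nat) (le_nm : (n <= m)%N) (lam : 'I_n -> nat).
Hypothesis lam_mono : forall i j : 'I_n, (i <= j)%N -> (lam j <= lam i)%N.

Local Notation mu := (fun i : 'I_n => i.+1).
Local Notation S := {mpoly K[m]}.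
Local Notation X := (gferrers_complex K m lam mu).
Local Notation w := (widen_ord le_nm).

Variable eps : face X -> face X -> int.
Hypothesis incP : incidence_function eps.

Local Notation inc := (inc eps).
Local Notation coef := (cellular_coef K (spec_label K le_nm lam mu) eps).
Let lab (P : face X) : 'X_{1..m} := mesym1 (fsupp le_nm P).

(** Multiplying by the labels turns the cellular boundary into the scalar matrix [inc]. This
    multiplication is injective, so identities over K transfer to S. *)
Lemma coefE P Q : coef P Q * 'X_[lab Q] = inc P Q *: 'X_[lab P].
Proof.
rewrite /cellular_coef /inc !face_labelE; case: ifP => [/andP[/(fsuppS le_nm) sub _]|_].
  rewrite -mulrA -mpolyXD submK ?mesym1_le // -mul_mpolyC.
  by rewrite rmorph_int.
by rewrite mul0r scale0r.
Qed.

Lemma coef_neq0 P Q : coef P Q != 0 -> facet Q P.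
Proof. by rewrite /cellular_coef; case: ifP; rewrite ?eqxx. Qed.

Lemma mulX_inj (u : 'X_{1..m}) (p q : S) : p * 'X_[u] = q * 'X_[u] -> p = q.
Proof.
by apply: mulIf; apply/eqP => /(congr1 (mcoeff u)); rewrite mcoeffX eqxx mcoeff0;
  apply/eqP/oner_neq0.
Qed.

Lemma coef_comp P R : \sum_Q coef P Q * coef Q R = 0.
Proof.
apply: (@mulX_inj (lab R)); rewrite mul0r mulr_suml.
transitivity (\sum_Q (inc P Q * inc Q R) *: 'X_[lab P] : S).
  apply: eq_bigr => Q _; rewrite -mulrA coefE -scalerAr coefE scalerA.
  by rewrite mulrC.
by rewrite -scaler_suml inc_comp // scale0r.
Qed.

Lemma mcoeff_mulX_le (p : S) l u : (p * 'X_[l])@_u != 0 -> (l <= u)%MM.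
Proof.
rewrite -mcoeff_msupp => /msuppM_le/allpairsP[[u1 u2] /= [_]].
by rewrite msuppX inE => /eqP-> ->; apply: lem_addl.
Qed.

(** Labels are squarefree, so the faces whose label divides x^u are those supported on the support W
    of u. If W carries no nonempty face, the condition at the empty face makes v vanish; otherwise
    any face in W supplies the column d for the matching. *)
Lemma degree_exact (u : 'X_{1..m}) (v : face X -> K) :
    (forall P, v P != 0 -> (lab P <= u)%MM) -> v (empty_face X) = 0 ->
    (forall Q, \sum_P v P * inc P Q = 0) ->
  exists x, (forall P, x P != 0 -> (lab P <= u)%MM) /\
    forall Q, v Q = \sum_P x P * inc P Q.
Proof.
move=> vu v0 cyc; pose W := [set i | u i != 0%N].
have leW P : (lab P <= u)%MM = (fsupp le_nm P \subset W).
  by apply/mesym1_leP/subsetP => sub i /sub; rewrite inE.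
have [/existsP[P /andP[PW r0]]|none] :=
    boolP [exists P : face X, (fsupp le_nm P \subset W) && (rows P != set0)]; last first.
  exists (fun=> 0); split=> [P|Q]; first by rewrite eqxx.
  rewrite big1 => [|P _]; last by rewrite mul0r.
  apply/eqP; apply: contraNT none => vQ; apply/existsP; exists Q.
  rewrite -leW vu //=; apply: contraNneq vQ => /eqP/empty_faceP->.
  by rewrite v0.
have [a0 aP] := set0Pn _ r0.
have [d dP] : exists b, b \in cols P by apply/set0Pn; rewrite -rows_eq0.
have /subsetP PW' := PW.
have a0W : w a0 \in W by apply: PW'; rewrite inE imset_f.
case: (arg_minnP (P := fun a => w a \in W) (fun a : 'I_n => a : nat) a0W) => c cW c_min.
have dW : d \in W by apply: PW'; rewrite inE dP orbT.
have /andP[lt_ad lt_d] := face_mem aP dP.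
have cd : (c < d < lam c)%N.
  have le_ca := c_min _ a0W.
  by rewrite (leq_ltn_trans le_ca) // (leq_trans lt_d) // lam_mono.
have [|x [xW xE]] := strand_exact (le_nm := le_nm) lam_mono incP cW dW cd c_min _ cyc.
  by move=> Q /vu; rewrite leW.
by exists x; split=> // Q; rewrite leW; apply: xW.
Qed.

(** In each multidegree u the coefficients of v P * x^(lab P) form a scalar cycle. The scalar
    primitives, found separately for the finitely many u that occur, are reassembled with the
    monomials x^(u - lab P), which make sense because the primitives live on faces with lab P <=
    u. *)
Lemma poly_exact (v : face X -> S) :
    v (empty_face X) = 0 -> (forall Q, \sum_P v P * coef P Q = 0) ->
  exists x, forall Q, v Q = \sum_P x P * coef P Q.
Proof.
move=> v0 cyc; pose vX P := v P * 'X_[lab P].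
have /choice[x xP] u : exists x, (forall P, x P != 0 -> (lab P <= u)%MM) /\
    forall Q, (vX Q)@_u = \sum_P x P * inc P Q.
  apply: degree_exact => [P|/=|Q].
  - exact: mcoeff_mulX_le.
  - by rewrite /vX v0 mul0r mcoeff0.
  - have := congr1 (fun p => (p * 'X_[lab Q])@_u) (cyc Q).
    rewrite mul0r mcoeff0 mulr_suml raddf_sum /= => sum0; rewrite -[RHS]sum0.
    apply: eq_bigr => P _.
    by rewrite -mulrA coefE -scalerAr mcoeffZ mulrC.
pose U := undup (flatten [seq msupp (vX P) | P <- enum (face X)]).
pose y P := \sum_(u <- U) x u P *: 'X_[u - lab P] : S.
have yX P : y P * 'X_[lab P] = \sum_(u <- U) x u P *: 'X_[u].
  rewrite mulr_suml; apply: eq_bigr => u _; rewrite -scalerAl -mpolyXD.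
  have [->|/(proj1 (xP u))/submK->//] := eqVneq (x u P) 0; first by rewrite !scale0r.
exists y => Q; apply: (@mulX_inj (lab Q)); rewrite mulr_suml -/(vX Q).
transitivity (\sum_(u <- U) (vX Q)@_u *: 'X_[u]).
  apply/mpolyP => t; rewrite raddf_sum /=; have [tU|tU] := boolP (t \in U).
    rewrite (bigD1_seq t) ?undup_uniq //= big1 => [|u ut].
      by rewrite mcoeffZ mcoeffX eqxx mulr1 addr0.
    by rewrite mcoeffZ mcoeffX (negPf ut) mulr0.
  rewrite big1_seq => [|u /= uU].
    apply: memN_msupp_eq0; apply: contra tU => tQ; rewrite mem_undup.
    by apply/flatten_mapP; exists Q; rewrite ?mem_enum.
  by rewrite mcoeffZ mcoeffX; case: eqP uU tU => [->->//|]; rewrite mulr0.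
transitivity (\sum_(u <- U) \sum_P (x u P * inc P Q) *: 'X_[u] : S).
  by apply: eq_bigr => u _; rewrite (proj2 (xP u)) scaler_suml.
rewrite exchange_big; apply: eq_bigr => P _ /=.
rewrite -mulrA coefE -scalerAr yX scaler_sumr; apply: eq_bigr => u _.
by rewrite scalerA mulrC.
Qed.

Local Notation F := (cellular_complex K (spec_label K le_nm lam mu) eps).

Lemma facet_cells k P Q : facet Q P -> (P \in cells X k.+1) = (Q \in cells X k).
Proof. by case/andP=> _ /eqP dimP; rewrite !inE dimP eqSS. Qed.

Lemma cells0_facet P : P \in cells X 0 -> facet (empty_face X) P.
Proof.
rewrite inE => /eqP dimP; rewrite /facet subfaceE rows_empty cols_empty !sub0set dimP.
by rewrite cdim1_empty.
Qed.

Lemma facet_vertex P Q : P \in cells X 0 -> facet Q P -> Q = empty_face X.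
Proof.
rewrite inE => /eqP dimP /andP[_]; rewrite dimP eqSS eq_sym cdim1_eq0.
by move/empty_faceP.
Qed.

Section Extension.
Variable k : nat.
Implicit Types (v : 'rV[S]_#|cells X k|) (c : face X -> S).

(** Extension by zero to all faces, so that exactness stated for functions on faces serves every
    homological degree. The sum has at most one term. *)
Definition ext v (P : face X) : S := \sum_(a | enum_val a == P) v 0 a.

Lemma ext_sum v c : \sum_P ext v P * c P = \sum_a v 0 a * c (enum_val a).
Proof.
rewrite [RHS](partition_big enum_val predT) //=; apply: eq_bigr => P _.
by rewrite mulr_suml; apply: eq_bigr => a /eqP->.
Qed.

Lemma ext_val v a : ext v (enum_val a) = v 0 a.
Proof.
rewrite /ext (bigD1 a) //= big1 ?addr0 // => b /andP[/eqP/enum_val_inj->].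
by rewrite eqxx.
Qed.

Lemma ext_out v P : P \notin cells X k -> ext v P = 0.
Proof.
by move=> nP; rewrite /ext big1 // => a /eqP aP; rewrite -aP enum_valP in nP.
Qed.

Lemma sum_cells c : (forall P, P \notin cells X k -> c P = 0) ->
  \sum_P c P = \sum_(a < #|cells X k|) c (enum_val a).
Proof.
move=> c0; rewrite -(big_enum_val (A := mem (cells X k)) c) /= [RHS]big_mkcond /=.
by apply: eq_bigr => P _; case: ifPn => // /c0.
Qed.
End Extension.

Lemma cellular_kernel k (v : 'rV[S]_#|cells X k|) :
    (forall Q, \sum_a v 0 a * coef (enum_val a) Q = 0) ->
  exists u : 'rV_#|cells X k.+1|, v = u *m diff F k.
Proof.
move=> cyc; have [||x xE] := @poly_exact (ext v).
- by apply: ext_out; rewrite inE cdim1_empty.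
- by move=> Q; rewrite (ext_sum v (coef^~ Q)).
exists (\row_a x (enum_val a)); apply/rowP => a; rewrite mxE -ext_val xE.
rewrite (sum_cells (k := k.+1)) => [|P nP].
  by apply: eq_bigr => b _; rewrite !mxE.
have [->|/coef_neq0/(facet_cells k)] := eqVneq (coef P (enum_val a)) 0.
  by rewrite mulr0.
by rewrite enum_valP (negPf nP).
Qed.

Lemma cellular_diff_diff k : diff F k.+1 *m diff F k = 0.
Proof.
apply/matrixP => a c; rewrite !mxE; apply: etrans (coef_comp (enum_val a) (enum_val c)).
rewrite (sum_cells (k := k.+1)) => [|P nP]; first by apply: eq_bigr => b _; rewrite !mxE.
have [->|/coef_neq0/(facet_cells k)] := eqVneq (coef P (enum_val c)) 0.
  by rewrite mulr0.
by rewrite enum_valP (negPf nP).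
Qed.

Lemma cellular_diff_aug : diff F 0 *m aug F = 0.
Proof.
apply/matrixP => a c; rewrite !mxE; apply: etrans (coef_comp (enum_val a) (empty_face X)).
rewrite (sum_cells (k := 0)) => [|P nP]; first by apply: eq_bigr => b _; rewrite !mxE.
have [->|] := eqVneq (coef P (empty_face X)) 0; first by rewrite mulr0.
move=> /coef_neq0/andP[_]; rewrite cdim1_empty.
by move: nP; rewrite inE => /negPf->.
Qed.

Lemma cells0P P : P \in cells X 0 ->
  exists a b, [/\ rows P = [set a], cols P = [set b] & (a < b < lam a)%N].
Proof.
rewrite inE => /eqP dimP.
have [a [b [Pa Pb]]] := vertexP dimP.
exists a, b; split=> //; apply: (@face_mem K n m lam P); by rewrite ?Pa ?Pb set11.
Qed.

Lemma lab_vertex P a b : rows P = [set a] -> cols P = [set b] -> (a < b)%N ->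
  lab P = (U_(w a) + U_(b))%MM.
Proof.
move=> Pa Pb lt_ab; apply/mnmP => k; rewrite mnmE mnmDE !mnm1E /fsupp Pa Pb.
rewrite imset_set1 !inE !(eq_sym k); case: (w a =P k) => [<-|] //=.
by rewrite -val_eqE /= gtn_eqF.
Qed.

Lemma lab_empty : lab (empty_face X) = 0%MM.
Proof. by rewrite /lab /fsupp rows_empty cols_empty imset0 setU0 mesym1_set0. Qed.

Lemma coef_vertex P : coef P (empty_face X) = inc P (empty_face X) *: 'X_[lab P].
Proof. by rewrite -coefE lab_empty mpolyX0 mulr1. Qed.

Lemma cellular_image f : f \in spec_gferrers_ideal K le_nm lam mu <->
  exists v : 'rV_#|cells X 0|, f = (v *m aug F) 0 0.
Proof.
split=> [fJ|[v ->]].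
  pose J := [pred f : S | `[< exists v : 'rV_#|cells X 0|, f = (v *m aug F) 0 0 >]].
  suff /(_ _ fJ)/asboolP : {subset spec_gferrers_ideal K le_nm lam mu <= J} by [].
  apply: ideal_gen_sub.
    split=> [|f1 f2 /asboolP[v1 ->] /asboolP[v2 ->]|a f1 /asboolP[v1 ->]]; apply/asboolP.
    - by exists 0; rewrite mul0mx mxE.
    - by exists (v1 + v2); rewrite mulmxDl [RHS]mxE.
    - by exists (a *: v1); rewrite -scalemxAl [RHS]mxE.
  move=> _ [i [j [ij ->]]]; apply/asboolP.
  have [|||ri cj] := @gfaceP K n m lam [set i] [set j].
  - by apply/set0Pn; exists i; rewrite set11.
  - by apply/set0Pn; exists j; rewrite set11.
  - by move=> a b /set1P-> /set1P->; exact: ij.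
  set P := gface _ _ _ _ in ri cj.
  have PX : P \in cells X 0 by rewrite inE cdim1E ri cj !cards1.
  (* The augmentation sends the vertex to x_i x_j up to the sign prescribed by the incidence
     function, which is divided out. *)
  exists ((inc P (empty_face X))^-1%:MP *: delta_mx 0 (enum_rank_in PX P)).
  rewrite -scalemxAl mxE -rowE !mxE enum_rankK_in // coef_vertex.
  rewrite mul_mpolyC scalerA mulVf ?scale1r ?inc_neq0 ?cells0_facet //.
  by rewrite (lab_vertex ri cj) ?mpolyXD //; case/andP: ij.
have idJ := is_ideal_gen (fun f : S => exists (i : 'I_n) (j : 'I_m),
    in_shape lam mu i j /\ f = 'X_(w i) * 'X_j).
rewrite mxE; apply: (is_ideal_sum idJ) => a _; apply: (is_idealM idJ).
rewrite mxE coef_vertex -mul_mpolyC; apply: (is_idealM idJ).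
have [i [j [ri cj ij]]] := cells0P (enum_valP a).
apply: mem_ideal_gen; exists i, j; split=> //.
by rewrite (lab_vertex ri cj) ?mpolyXD //; case/andP: ij.
Qed.

Lemma multidegreeD (u v : 'X_{1..m}) : multidegree (u + v)%MM = multidegree u + multidegree v.
Proof. by apply/rowP => j; rewrite !mxE mnmDE PoszD. Qed.

Lemma coef_msupp P Q u : u \in msupp (coef P Q) -> lab P = (lab Q + u)%MM.
Proof.
rewrite mcoeff_msupp -(mcoeffMX _ (lab Q)) coefE mcoeffZ mcoeffX.
by case: (lab P =P _) => // _; rewrite mulr0 eqxx.
Qed.

Lemma cellular_resolution :
  min_graded_resolution (@multidegree m) (spec_gferrers_ideal K le_nm lam mu)
    (zero_ideal K m) F.
Proof.
split; first split.
- move=> a u; rewrite mxE => /coef_msupp; rewrite lab_empty add0m => <-.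
  by rewrite /= face_labelE.
- move=> k a b u; rewrite mxE => /coef_msupp e.
  by rewrite /= !face_labelE -multidegreeD -e.
- split.
  + move=> f; rewrite cellular_image; split=> [[v ->]|[v [g [/eqP-> ->]]]].
      by exists v, 0; rewrite inE eqxx addr0.
    by exists v; rewrite addr0.
  + move=> v; rewrite inE; split=> [/eqP v0|[u ->]]; last first.
      by rewrite -mulmxA cellular_diff_aug mulmx0 mxE.
    apply: cellular_kernel => Q; have [->|Q0] := eqVneq Q (empty_face X).
      by rewrite -[RHS]v0 mxE; apply: eq_bigr => a _; rewrite mxE.
    rewrite big1 // => a _; have [->|] := eqVneq (coef (enum_val a) Q) 0.
      by rewrite mulr0.
    by move=> /coef_neq0/(facet_vertex (enum_valP a)) e; rewrite e eqxx in Q0.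
  + move=> k v; split=> [v0|[u ->]]; last first.
      by rewrite -mulmxA cellular_diff_diff mulmx0.
    apply: cellular_kernel => Q; have [QX|nQ] := boolP (Q \in cells X k).
      have := congr1 (fun A => fun_of_matrix A 0 (enum_rank_in QX Q)) v0.
      rewrite !mxE => sum0; rewrite -[RHS]sum0; apply: eq_bigr => a _.
      by rewrite mxE enum_rankK_in.
    rewrite big1 // => a _; have [->|] := eqVneq (coef (enum_val a) Q) 0.
      by rewrite mulr0.
    by move=> /coef_neq0/(facet_cells k); rewrite enum_valP (negPf nQ).
- move=> k a b; rewrite mxE.
  set P := enum_val a; set Q := enum_val b.
  have [->|c0] := eqVneq (coef P Q) 0; first by case: (is_ideal_irr K m).
  have /andP[sub /eqP dimP] := coef_neq0 c0.
  rewrite /cellular_coef (coef_neq0 c0); apply: is_idealM; first exact: is_ideal_irr.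
  rewrite !face_labelE.
  have Qr : rows Q != set0.
    by have := enum_valP b; rewrite inE -cdim1_eq0 => /eqP->.
  have Pr : rows P != set0.
    by have := enum_valP a; rewrite inE -cdim1_eq0 => /eqP->.
  (* The support of a nonempty face has dimension plus two elements, so passing to a facet of
     positive codimension loses a variable, and that variable divides the coefficient. *)
  have /card_gt0P[i] : (0 < #|fsupp le_nm P :\: fsupp le_nm Q|)%N.
    rewrite cardsD (setIidPr (fsuppS le_nm sub)) !card_fsupp.
    by rewrite -!cdim1_nonempty // dimP subSn // subnn.
  case/setDP=> iP iQ.
  have iu : (U_(i) <= mesym1 (fsupp le_nm P) - mesym1 (fsupp le_nm Q))%MM.
    by rewrite lep1mP mnmBE !mnmE iP (negPf iQ).
  rewrite -(submK iu) mpolyXD; apply: is_idealM; first exact: is_ideal_irr.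
  by apply: mem_ideal_gen; exists i.
Qed.

End Resolution.

(** * An incidence function *)

Section Incidence.
Variables (K : fieldType) (n m : nat) (le_nm : (n <= m)%N) (lam : 'I_n -> nat).

Local Notation mu := (fun i : 'I_n => i.+1).
Local Notation X := (gferrers_complex K m lam mu).
Local Notation w := (widen_ord le_nm).

Definition below (Y : {set 'I_m}) (x : 'I_m) : nat := #|[set y in Y | (y < x)%N]|.

Lemma belowD1 (Y : {set 'I_m}) x y : y \in Y -> below Y x = (below (Y :\ y) x + (y < x)%N)%N.
Proof.
move=> yY; rewrite /below (cardsD1 y) inE yY /= addnC; congr (#|pred_of_set _| + _)%N.
by apply/setP => z; rewrite !inE andbA.
Qed.

(** For Z = Y minus x this is the simplicial sign, given by the position of x in Y; the sum extends
    it to arbitrary pairs. *)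
Definition removal_sign (Y Z : {set 'I_m}) : int := (-1) ^+ (\sum_(x in Y :\: Z) below Y x).

Lemma removal_sign1 (Y Z : {set 'I_m}) x :
  Y :\: Z = [set x] -> removal_sign Y Z = (-1) ^+ below Y x.
Proof. by rewrite /removal_sign => ->; rewrite big_set1. Qed.

(** Removing the smaller of x and y shifts the position of the larger by one, whereas removing the
    larger leaves the position of the smaller unchanged. *)
Lemma removal_sign_swap (Y : {set 'I_m}) x y : x \in Y -> y \in Y -> x != y ->
  (-1) ^+ below Y x * (-1) ^+ below (Y :\ x) y
    = - ((-1) ^+ below Y y * (-1) ^+ below (Y :\ y) x) :> int.
Proof.
move=> xY yY; rewrite (belowD1 x yY) (belowD1 y xY) -val_eqE /= !exprD.
by case: ltngtP => //= _ _; rewrite ?expr0 ?expr1; ring.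
Qed.

Definition face_sign (P Q : face X) : int :=
  if rows Q == set0 then 1 else removal_sign (fsupp le_nm P) (fsupp le_nm Q).

(** * Cancellation in intervals of length two *)

Section Interval.
Variables (P : face X) (A0 : {set 'I_n}) (B0 : {set 'I_m}).
Hypotheses (A0P : A0 \subset rows P) (B0P : B0 \subset cols P).
Let C0 := w @: A0 :|: B0.
Hypothesis card0 : (#|rows P| + #|cols P| = #|A0| + #|B0| + 2)%N.
Hypothesis between : forall (A : {set 'I_n}) (B : {set 'I_m}),
  A0 \subset A -> A \subset rows P -> B0 \subset B -> B \subset cols P ->
  (#|A| + #|B| = #|A0| + #|B0| + 1)%N -> A != set0 /\ B != set0.

(** The lower end (A0, B0) need not be a face. It will be a nonempty face R, or, when P is an edge
    lying over the empty face, the single row or column common to its two endpoints; [between]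
    guarantees that the middle pairs are faces. *)
Definition in_interval (Q : face X) :=
  [&& subface Q P, A0 \subset rows Q, B0 \subset cols Q &
      (#|rows Q| + #|cols Q| == #|A0| + #|B0| + 1)%N].

(** Complementation inside the interval, which exchanges its two middle elements. *)
Definition swap (Q : face X) : face X :=
  gface K lam (A0 :|: (rows P :\: rows Q)) (B0 :|: (cols P :\: cols Q)).

Lemma card_interval : #|C0| = (#|A0| + #|B0|)%N.
Proof.
rewrite cardsU card_imset; last exact: widen_inj.
rewrite [X in (_ - X)%N](_ : _ = 0%N) ?subn0 //.
apply/eqP; rewrite cards_eq0 setI_eq0; apply/pred0P => k /=; apply/negP => /andP[].
case/imsetP=> a aP ->; apply/negP; apply: contra (fsupp_disjoint le_nm (subsetP A0P _ aP)).
exact: (subsetP B0P).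
Qed.

Lemma card_swap Q : in_interval Q ->
  (#|A0 :|: (rows P :\: rows Q)| + #|B0 :|: (cols P :\: cols Q)| = #|A0| + #|B0| + 1)%N.
Proof.
case/and4P=> /andP[rQP cQP] A0Q B0Q /eqP cardQ.
have cardU (T : finType) (E F G : {set T}) : E \subset F -> F \subset G ->
    (#|E :|: (G :\: F)| = #|E| + (#|G| - #|F|))%N.
  move=> EF FG; rewrite cardsU cardsD (setIidPr FG).
  rewrite [X in (_ - X)%N](_ : _ = 0%N) ?subn0 //; apply/eqP; rewrite cards_eq0.
  apply/eqP/setP => z; rewrite !inE; apply/negP => /and3P[zE zF _].
  by rewrite (subsetP EF) in zF.
rewrite !cardU //; have := subset_leq_card rQP; have := subset_leq_card cQP.
move: card0 cardQ; rewrite -/(rows P) -/(rows Q) -/(cols P) -/(cols Q).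
move: #|rows P| #|rows Q| #|cols P| #|cols Q| #|A0| #|B0| => p1 q1 p2 q2 a b.
by clear; lia.
Qed.

Lemma rows_swap Q : in_interval Q ->
  rows (swap Q) = A0 :|: (rows P :\: rows Q) /\ cols (swap Q) = B0 :|: (cols P :\: cols Q).
Proof.
move=> QI.
have A'P : A0 :|: (rows P :\: rows Q) \subset rows P by rewrite subUset A0P subsetDl.
have B'P : B0 :|: (cols P :\: cols Q) \subset cols P by rewrite subUset B0P subsetDl.
have [A'0 B'0] := between (subsetUl _ _) A'P (subsetUl _ _) B'P (card_swap QI).
apply: gfaceP => // a b aA bB; apply: (@face_mem K n m lam P).
  by case/setUP: aA => [/(subsetP A0P)|/setDP[]].
by case/setUP: bB => [/(subsetP B0P)|/setDP[]].
Qed.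

Lemma swap_interval Q : in_interval Q -> in_interval (swap Q).
Proof.
move=> QI; have [rS cS] := rows_swap QI.
rewrite /in_interval subfaceE rS cS !subsetUl card_swap // eqxx !andbT.
by rewrite !subUset A0P B0P !subsetDl.
Qed.

Lemma swapK Q : in_interval Q -> swap (swap Q) = Q.
Proof.
move=> QI; have [rS cS] := rows_swap QI.
have [rSS cSS] := rows_swap (swap_interval QI).
case/and4P: QI => /andP[rQP cQP] A0Q B0Q _.
have setK (T : finType) (E F G : {set T}) : E \subset F -> F \subset G ->
    E :|: (G :\: (E :|: (G :\: F))) = F.
  move=> /subsetP EF /subsetP FG; apply/setP => z; rewrite !inE.
  have [zE|_] /= := boolP (z \in E); first by rewrite EF.
  have [zF|_] /= := boolP (z \in F); first by rewrite FG.
  by case: (z \in G).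
by apply: face_inj; rewrite ?rSS ?cSS ?rS ?cS setK.
Qed.

Lemma interval_supp Q : in_interval Q -> exists x y,
  [/\ x \in fsupp le_nm P, y \in fsupp le_nm P, x != y,
      fsupp le_nm Q = fsupp le_nm P :\ x & fsupp le_nm Q :\: C0 = [set y]].
Proof.
case/and4P=> sub A0Q B0Q /eqP cardQ.
have subC : fsupp le_nm Q \subset fsupp le_nm P by apply: fsuppS.
have C0Q : C0 \subset fsupp le_nm Q by rewrite setUSS ?imsetS.
have /cards1P[x xE] : #|fsupp le_nm P :\: fsupp le_nm Q| == 1%N.
  by rewrite cardsD (setIidPr subC) !card_fsupp card0 cardQ subnDl.
have /cards1P[y yE] : #|fsupp le_nm Q :\: C0| == 1%N.
  by rewrite cardsD (setIidPr C0Q) card_fsupp cardQ card_interval addKn.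
have /setDP[xP xQ] : x \in fsupp le_nm P :\: fsupp le_nm Q by rewrite xE set11.
have /setDP[yQ _] : y \in fsupp le_nm Q :\: C0 by rewrite yE set11.
exists x, y; split=> //; first exact: (subsetP subC).
  by apply: contraNneq xQ => ->.
by rewrite -xE setDDr setDv set0U (setIidPr subC).
Qed.

Lemma fsupp_swap Q : in_interval Q ->
  fsupp le_nm (swap Q) = C0 :|: (fsupp le_nm P :\: fsupp le_nm Q).
Proof.
move=> QI; have [rS cS] := rows_swap QI; rewrite /fsupp rS cS imsetU.
case/and4P: QI => /andP[rQP cQP] _ _ _.
rewrite setUACA; congr (_ :|: _); apply/setP => k; apply/setUP/setDP.
  case=> [/imsetP[a /setDP[aP aQ] ->]|/setDP[kP kQ]].
    split; first by rewrite inE imset_f.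
    rewrite inE negb_or (mem_imset _ _ (@widen_inj _ _ le_nm)) aQ /=.
    by apply: contra (fsupp_disjoint le_nm aP); apply: (subsetP cQP).
  split; first by rewrite inE kP orbT.
  rewrite inE negb_or kQ andbT; apply/negP => /imsetP[a aQ kE].
  by have := fsupp_disjoint le_nm (subsetP rQP _ aQ); rewrite -kE kP.
case; rewrite !inE negb_or => /orP[/imsetP[a aP ->]|kP] /andP[kr kc].
  left; apply: imset_f; rewrite inE aP andbT.
  by apply: contra kr; apply: imset_f.
by right; rewrite kc.
Qed.

(** The involution [swap] reverses the order in which the two elements are removed, hence changes
    the sign of each term. The sum equals its own negative, so it is 0 in the integers. *)
Lemma interval_sum :
  \sum_(Q | in_interval Q)
    removal_sign (fsupp le_nm P) (fsupp le_nm Q) * removal_sign (fsupp le_nm Q) C0 = 0.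
Proof.
set s := \sum_(Q | _) _; suff: s = - s by lia.
rewrite {1}/s (reindex_onto swap swap) => [|Q]; last exact: swapK.
rewrite -sumrN; apply: eq_big => [Q|Q QI].
  apply/andP/idP => [[SI /eqP SK]|QI]; first by rewrite -SK swap_interval.
  by rewrite swapK ?eqxx ?swap_interval.
have {}QI : in_interval Q.
  by case/andP: QI => SI /eqP <-; apply: swap_interval.
have [x [y [xP yP xy QE yE]]] := interval_supp QI.
have C0Q : C0 \subset fsupp le_nm Q.
  by case/and4P: QI => _ A0Q B0Q _; rewrite setUSS ?imsetS.
have yQ : y \in fsupp le_nm Q :\: C0 by rewrite yE set11.
have C0E : C0 = fsupp le_nm P :\ x :\ y.
  by rewrite -QE -yE setDDr setDv set0U (setIidPr C0Q).
have SE : fsupp le_nm (swap Q) = fsupp le_nm P :\ y.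
  rewrite fsupp_swap // C0E QE; clear -xP yP xy.
  move: (fsupp le_nm P) xP yP => Z xZ yZ; apply/setP => z; rewrite !inE.
  have [->|_] := eqVneq z y; first by rewrite yZ eq_sym xy.
  by have [->|_] := eqVneq z x; rewrite ?xZ //; case: (z \in Z).
have -> : removal_sign (fsupp le_nm P) (fsupp le_nm Q) = (-1) ^+ below (fsupp le_nm P) x.
  by apply: removal_sign1; rewrite QE setDDr setDv set0U; apply/setIidPr; rewrite sub1set.
have -> : removal_sign (fsupp le_nm Q) C0 = (-1) ^+ below (fsupp le_nm P :\ x) y.
  by rewrite -QE; apply: removal_sign1.
have -> : removal_sign (fsupp le_nm P) (fsupp le_nm (swap Q)) = (-1) ^+ below (fsupp le_nm P) y.
  by apply: removal_sign1; rewrite SE setDDr setDv set0U; apply/setIidPr; rewrite sub1set.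
have -> : removal_sign (fsupp le_nm (swap Q)) C0 = (-1) ^+ below (fsupp le_nm P :\ y) x.
  rewrite -SE; apply: removal_sign1; rewrite SE C0E; clear -xP xy.
  move: (fsupp le_nm P) xP => Z xZ; apply/setP => z; rewrite !inE.
  have [->|_] := eqVneq z x; first by rewrite xy xZ.
  by case: (z == y); case: (z \in Z).
by rewrite removal_sign_swap // eq_sym.
Qed.

End Interval.

Lemma face_sign_incidence : incidence_function face_sign.
Proof.
have sgn (Y Z : {set 'I_m}) : removal_sign Y Z = 1 \/ removal_sign Y Z = -1.
  by rewrite /removal_sign -signr_odd; case: odd; [right|left].
split=> [P Q _|P R sub dimP].
  by rewrite /face_sign; case: ifP => _; [left|].
have r0 : rows P != set0 by rewrite -cdim1_eq0 dimP.
have cardP := cdim1_nonempty r0; rewrite dimP in cardP.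
have [R0|R0] := boolP (rows R == set0); last first.
  have cardR := cdim1_nonempty R0.
  have [sr sc] := andP sub.
  have card0 : (#|rows P| + #|cols P| = #|rows R| + #|cols R| + 2)%N.
    by rewrite -cardP -cardR addn2.
  have := @interval_sum P (rows R) (cols R) sr sc card0.
  have rw : w @: rows R :|: cols R = fsupp le_nm R by [].
  rewrite rw => sum0; rewrite -[RHS]sum0; last first.
    move=> A B RA _ RB _ _; split; apply/set0Pn.
      by have [a aR] := set0Pn _ R0; exists a; apply: (subsetP RA).
    by rewrite rows_eq0 in R0; have [b bR] := set0Pn _ R0; exists b; apply: (subsetP RB).
  apply: eq_big => [Q|Q].
    rewrite /facet /in_interval subfaceE [subface R Q]subfaceE -!andbA.
    do 2!congr (_ && _); have [rRQ|] := boolP (rows R \subset rows Q); last by rewrite !andFb !andbF.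
    rewrite !andTb.
    have Q0 : rows Q != set0 by apply: contraNneq R0 => Q0; rewrite Q0 subset0 in rRQ.
    rewrite -(cdim1_nonempty Q0) -cardR addn1 dimP !eqSS.
    by rewrite [_.+1 == _]eq_sym andbCA; case: (_ == _); rewrite ?andbT ?andbF.
  case/andP=> /andP[_ /eqP dQ] /andP[_ /eqP dR].
  have Q0 : rows Q != set0 by rewrite -cdim1_eq0 dR.
  by rewrite /face_sign (negPf R0) (negPf Q0).
have RE : R = empty_face X by apply/empty_faceP.
have dimR : cdim1 R = 0%N by rewrite RE cdim1_empty.
have c0 : cols P != set0 by rewrite -rows_eq0.
pose C0 (A0 : {set 'I_n}) (B0 : {set 'I_m}) := w @: A0 :|: B0.
(* Here R is empty and P is an edge. The interval above the row or column shared by its endpoints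
   has vanishing sum, and the sign s from an endpoint down to that element is the same for both
   endpoints, so it can be factored out. *)
suff edge (A0 : {set 'I_n}) (B0 : {set 'I_m}) (s : int) : A0 \subset rows P -> B0 \subset cols P ->
     (#|A0| + #|B0| = 1)%N ->
     (forall (A : {set 'I_n}) (B : {set 'I_m}), A0 \subset A -> A \subset rows P ->
        B0 \subset B -> B \subset cols P -> (#|A| + #|B| = 2)%N -> A != set0 /\ B != set0) ->
     (forall Q, subface Q P -> cdim1 Q = 1%N -> A0 \subset rows Q /\ B0 \subset cols Q) ->
     (forall Q, in_interval P A0 B0 Q -> removal_sign (fsupp le_nm Q) (C0 A0 B0) = s) ->
     s * s = 1 ->
     \sum_(Q | facet Q P && facet R Q) face_sign P Q * face_sign Q R = 0.
  move: cardP r0 c0; rewrite dimR -!card_gt0 => card3 r_gt0 c_gt0.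
  have [/eqP/cards1P[a Pa]|r1] := eqVneq #|rows P| 1%N.
    (* The endpoints are {a} x {b}, and the removed column b has exactly the element a below it. *)
    have := edge (rows P) set0 (-1); apply; rewrite ?sub0set ?Pa ?cards1 ?cards0 //.
    - move=> A B aA Aa _ _ card2; have AE : A = [set a].
        by apply/eqP; rewrite eqEsubset Aa aA.
      move: card2; rewrite AE cards1 add1n => -[] card1; rewrite -!card_gt0 cards1 card1.
      by [].
    - move=> Q; rewrite subfaceE sub0set Pa => /andP[rQ _] dimQ.
      have [a' [b' [Qa _]]] := vertexP dimQ.
      by move: rQ; rewrite Qa !sub1set !inE eq_sym => ->; split; rewrite ?sub0set.
    - move=> Q /and4P[/andP[rQP cQP] rPQ _ /eqP]; rewrite cards1 cards0 => card2.
      have Qa : rows Q = [set a].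
        by apply/eqP; rewrite eqEsubset; apply/andP; split=> //; rewrite -Pa.
      have /cards1P[b Qb] : #|cols Q| == 1%N.
        by move/eqP: card2; rewrite Qa cards1 addn0 eqn_add2l.
      have ab : (a < b)%N.
        by have /andP[] := @face_mem K n m lam Q a b ltac:(by rewrite Qa set11)
          ltac:(by rewrite Qb set11).
      have ba : b != w a by rewrite -val_eqE /= gtn_eqF.
      rewrite (@removal_sign1 _ _ b); last first.
        rewrite /fsupp /C0 Qa Qb setU0; apply/setP => z; rewrite !inE imset_set1 !inE.
        by have [->|_] := eqVneq z b; rewrite ?ba ?orbT ?orbF ?andNb.
      rewrite (_ : below _ _ = 1%N) ?expr1 //.
      apply/eqP/cards1P; exists (w a); rewrite /fsupp Qa Qb imset_set1.
      apply/setP => z; rewrite !inE; have [->|_] := eqVneq z (w a) => //=.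
      by have [->|] := eqVneq z b; rewrite ?ltnn.
  have [rP2 cP1] : #|rows P| = 2%N /\ #|cols P| = 1%N.
    move: #|rows P| #|cols P| r1 r_gt0 c_gt0 card3 => r c; clear.
    by case: r c => [|[|[|r]]] [|[|c]] //; rewrite ?addnS.
  have /cards1P[b Pb] : #|cols P| == 1%N by apply/eqP.
  (* Here the removed element is the row, which lies below the common column, so the sign is 1. *)
  have := edge set0 (cols P) 1; apply; rewrite ?sub0set ?Pb ?cards1 ?cards0 //.
  - move=> A B _ _ bB Bb card2; have BE : B = [set b].
      by apply/eqP; rewrite eqEsubset Bb bB.
    move: card2; rewrite BE cards1 addn1 => -[] card1; rewrite -!card_gt0 cards1 card1.
    by [].
  - move=> Q; rewrite subfaceE sub0set Pb => /andP[_ cQ] dimQ.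
    have [a' [b' [_ Qb]]] := vertexP dimQ.
    by move: cQ; rewrite Qb !sub1set !inE eq_sym => ->; split; rewrite ?sub0set.
  - move=> Q /and4P[/andP[rQP cQP] _ cPQ /eqP]; rewrite cards1 cards0 => card2.
    have Qb : cols Q = [set b].
      by apply/eqP; rewrite eqEsubset; apply/andP; split=> //; rewrite -Pb.
    have /cards1P[a Qa] : #|rows Q| == 1%N.
      by move/eqP: card2; rewrite Qb cards1 add0n eqn_add2r.
    have ab : (a < b)%N.
      by have /andP[] := @face_mem K n m lam Q a b ltac:(by rewrite Qa set11)
        ltac:(by rewrite Qb set11).
    have ba : b != w a by rewrite -val_eqE /= gtn_eqF.
    rewrite (@removal_sign1 _ _ (w a)); last first.
      rewrite /fsupp /C0 Qa Qb imset0 set0U; apply/setP => z; rewrite !inE imset_set1 !inE.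
      by have [->|_] := eqVneq z b; rewrite ?(negPf ba) ?orbT ?orbF.
    rewrite (_ : below _ _ = 0%N) ?expr0 //.
    apply/eqP; rewrite cards_eq0 /fsupp Qa Qb imset_set1.
    apply/eqP/setP => z; rewrite !inE; have [->|_] := eqVneq z (w a); first by rewrite ltnn.
    by have [->|] //= := eqVneq z b; rewrite ltnNge ltnW.
move=> A0P B0P card0 between cover sE ss.
have sum0 := interval_sum A0P B0P.
have {}sum0 : \sum_(Q | in_interval P A0 B0 Q)
    removal_sign (fsupp le_nm P) (fsupp le_nm Q) * s = 0.
  rewrite -[RHS]sum0 ?card0 -?cardP ?dimR //.
    by apply: eq_bigr => Q /sE <-.
rewrite -[LHS]mulr1 -ss mulrA; suff -> : (\sum_(Q | facet Q P && facet R Q)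
    face_sign P Q * face_sign Q R) * s = 0 by rewrite mul0r.
rewrite -[RHS]sum0 mulr_suml; apply: eq_big => [Q|Q /andP[_ /andP[_ /eqP dimQ]]]; last first.
  have Q0 : rows Q != set0 by rewrite -cdim1_eq0 dimQ.
  by rewrite /face_sign R0 (negPf Q0) mulr1.
apply/andP/and4P => [[/andP[subQ _] /andP[_ /eqP dimQ]]|[subQ AQ BQ /eqP cardQ]].
  rewrite dimR in dimQ; have [AQ BQ] := cover _ subQ dimQ; split=> //.
  by rewrite -cdim1_nonempty ?dimQ ?card0 // -cdim1_eq0 dimQ.
have [rQP cQP] := andP subQ.
have [Q0 _] := between _ _ AQ rQP BQ cQP (etrans cardQ (congr1 (addn^~ 1%N) card0)).
have dimQ : cdim1 Q = 1%N.
  by have := cdim1_nonempty Q0; rewrite cardQ card0 => -[].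
rewrite /facet subQ dimP dimQ dimR subfaceE RE rows_empty cols_empty !sub0set.
by [].
Qed.

End Incidence.

(** * Counting faces *)

Section Counting.
Variables (K : fieldType) (n m : nat) (le_nm : (n <= m)%N) (lam : 'I_n -> nat).
Hypothesis lam_mono : forall i j : 'I_n, (i <= j)%N -> (lam j <= lam i)%N.
Hypothesis lam_le : forall i, (lam i <= m)%N.
Hypothesis lam_gt : forall i : 'I_n, (i < lam i)%N.

Local Notation mu := (fun i : 'I_n => i.+1).
Local Notation X := (gferrers_complex K m lam mu).
Local Notation w := (widen_ord le_nm).

Definition top_row (a : 'I_n) (P : face X) : bool :=
  (a \in rows P) && [forall i in rows P, (i <= a)%N].

Lemma card_ord_lt t : (t <= m)%N -> #|[set j : 'I_m | (j < t)%N]| = t.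
Proof.
move=> tm; rewrite -[RHS]card_ord -(card_imset _ (@widen_inj _ _ tm)).
apply: eq_card => j; rewrite inE; apply/idP/imsetP => [jt|[i _ ->]]; last exact: (ltn_ord i).
by exists (Ordinal jt) => //; apply: val_inj.
Qed.

Lemma cells_top_row k : #|cells X k| = (\sum_a #|[set P in cells X k | top_row a P]|)%N.
Proof.
have -> : (\sum_a #|[set P in cells X k | top_row a P]|
    = \sum_a \sum_(P in cells X k) (top_row a P : nat))%N.
  by apply: eq_bigr => a _; rewrite -sum1_card big_mkcond /= [RHS]big_mkcond;
    apply: eq_bigr => P _; rewrite inE; case: (P \in _); case: top_row.
rewrite exchange_big -sum1_card; apply: eq_bigr => P PX /=.
have r0 : rows P != set0 by move: PX; rewrite inE -cdim1_eq0 => /eqP->.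
have [a0 a0P] := set0Pn _ r0.
case: (arg_maxnP (P := fun a => a \in rows P) (fun a : 'I_n => a : nat) a0P) => a aP a_max.
rewrite (bigD1 a) //= big1 => [|b ba].
  by rewrite /top_row aP addn0 (introT forall_inP) // => i iP; apply: a_max.
rewrite /top_row; case: (boolP (b \in rows P)) => //= bP; case: forall_inP => // b_max.
by case/eqP: ba; apply/val_inj/eqP; rewrite eqn_leq b_max // andbT; apply: a_max.
Qed.

(** All columns exceed all rows, so cutting the support just after the largest row recovers the
    face. *)
Lemma top_rowP a (P : face X) : top_row a P ->
  [/\ forall i, (w i \in fsupp le_nm P) && (i <= a)%N = (i \in rows P)
    & forall j, (j \in fsupp le_nm P) && (a < j)%N = (j \in cols P)].
Proof.
case/andP=> aP /forall_inP a_max.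
have cols_gt j : j \in cols P -> (a < j)%N by move/(face_mem aP)/andP; case.
split=> [i|j].
  rewrite inE (mem_imset _ _ (@widen_inj _ _ le_nm)).
  have [iP|iP] := boolP (i \in rows P); first by rewrite a_max.
  by apply/negP => /andP[/cols_gt]; rewrite /= ltnNge => /negP.
rewrite inE; have [jP|jP] := boolP (j \in cols P); first by rewrite orbT cols_gt.
rewrite orbF; apply/negP => /andP[/imsetP[i iP ->]] /=.
by rewrite ltnNge a_max.
Qed.

(** Removing a from the support is a bijection onto the (k+1)-subsets of {0, ..., lam a - 1} minus a
    that are not contained in {0, ..., a - 1}; the excluded subsets would leave no column. *)
Lemma card_top_row a k :
  #|[set P in cells X k | top_row a P]| = ('C(lam a - 1, k.+1) - 'C(a, k.+1))%N.
Proof.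
pose f (P : face X) := fsupp le_nm P :\ w a.
pose T := [set j : 'I_m | (j < lam a)%N] :\ w a.
pose T0 := [set j : 'I_m | (j < a)%N].
have cardT : #|T| = (lam a - 1)%N.
  have := card_ord_lt (lam_le a); rewrite (cardsD1 (w a)) inE /= lam_gt.
  by move=> <-; rewrite add1n subn1.
have cardT0 : #|T0| = a by apply: card_ord_lt; apply: ltnW; apply: leq_trans le_nm.
have T0T : T0 \subset T.
  apply/subsetP => j; rewrite !inE -val_eqE /= => ja.
  by rewrite neq_ltn ja /= (ltn_trans ja).
pose S1 := [set D : {set 'I_m} | (D \subset T) && (#|D| == k.+1)].
pose S0 := [set D : {set 'I_m} | (D \subset T0) && (#|D| == k.+1)].
have S01 : S0 \subset S1.
  apply/subsetP => D; rewrite !inE => /andP[DT0 ->].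
  by rewrite (subset_trans DT0).
rewrite -cardT -cardT0 -!cards_draws -/S1 -/S0 -(setIidPr S01) -cardsD.
have f_inj : {in [set P in cells X k | top_row a P] &, injective f}.
  move=> P Q; rewrite !inE => /andP[_ aP] /andP[_ aQ] fPQ.
  have PQ : fsupp le_nm P = fsupp le_nm Q.
    have wP R : top_row a R -> w a \in fsupp le_nm R.
      by case/andP=> aR _; rewrite inE imset_f.
    by rewrite -(setD1K (wP _ aP)) -(setD1K (wP _ aQ)) -/(f P) fPQ.
  have [rP cP] := top_rowP aP; have [rQ cQ] := top_rowP aQ.
  by apply: face_inj; apply/setP => i; rewrite -?rP -?rQ -?cP -?cQ PQ.
rewrite -(card_in_imset f_inj); apply: eq_card => D; apply/imsetP/setDP.
  case=> P; rewrite inE => /andP[PX aP] ->.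
  have [rP cP] := top_rowP aP; have /andP[aPr /forall_inP a_max] := aP.
  have waP : w a \in fsupp le_nm P by rewrite inE imset_f.
  have r0 : rows P != set0 by apply/set0Pn; exists a.
  have cardf : #|f P| = k.+1.
    have := card_fsupp le_nm P; rewrite -cdim1_nonempty // (cardsD1 (w a)) waP add1n.
    by move: PX; rewrite inE => /eqP-> [].
  split.
    rewrite inE cardf eqxx andbT; apply: setSD; apply/subsetP => j.
    rewrite !inE => /orP[/imsetP[i iP ->]|jP].
      by rewrite /= (leq_ltn_trans (a_max _ iP)).
    by have /andP[] := face_mem aPr jP.
  rewrite inE cardf eqxx andbT; apply/negP => /subsetP sub.
  have [b bP] : exists b, b \in cols P by apply/set0Pn; rewrite -rows_eq0.
  have /andP[ab _] := face_mem aPr bP.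
  have /sub : b \in f P by rewrite !inE bP orbT andbT -val_eqE /= gtn_eqF.
  by rewrite inE ltnNge ltnW.
case; rewrite !inE => /andP[DT cardD]; rewrite cardD andbT => DT0.
have /subsetP DT' := DT.
pose A := a |: [set i : 'I_n | (w i \in D) && (i < a)%N].
pose B := [set j in D | (a < j)%N].
have [|||rP cP] := @gfaceP K n m lam A B.
- by apply/set0Pn; exists a; rewrite setU11.
- case/subsetPn: DT0 => j jD; rewrite inE -leqNgt => aj; apply/set0Pn; exists j.
  rewrite inE jD ltn_neqAle aj andbT /=.
  have := DT' _ jD; rewrite !inE -val_eqE /= => /andP[+ _].
  by rewrite eq_sym.
- move=> i j iA; rewrite inE => /andP[jD aj].
  have ia : (i <= a)%N.
    by move: iA; rewrite !inE => /orP[/eqP->//|/andP[_ /ltnW]].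
  rewrite (leq_ltn_trans ia) //; apply: leq_trans (lam_mono ia).
  by have := DT' _ jD; rewrite !inE => /andP[].
set P := gface _ _ _ _ in rP cP.
have aP : top_row a P.
  rewrite /top_row rP setU11 /=; apply/forall_inP => i.
  by rewrite !inE => /orP[/eqP->//|/andP[_ /ltnW]].
have waD : w a \notin D.
  by apply/negP => /DT'; rewrite !inE eqxx.
have fP : f P = D.
  apply/setP => j; rewrite !inE rP cP.
  have [->|ja] := eqVneq j (w a); first by rewrite (negPf waD).
  rewrite /= inE; have [jD|jD] := boolP (j \in D); last first.
    rewrite orbF; apply/negP => /imsetP[i]; rewrite !inE => /orP[/eqP->|/andP[iD _]] je.
      by rewrite je eqxx in ja.
    by rewrite je iD in jD.
  have [aj|ja'|e] := ltngtP a j; first by rewrite orbT.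
    have jn : (j < n)%N by apply: ltn_trans ja' (ltn_ord a).
    rewrite orbF; apply/imsetP; exists (Ordinal jn); last exact: val_inj.
    by rewrite !inE /= ja' (_ : w (Ordinal jn) = j) ?jD ?orbT //; apply: val_inj.
  by case/eqP: ja; apply: val_inj.
exists P => //; rewrite !inE aP andbT.
have aPr : a \in rows P by rewrite rP setU11.
have waP : w a \in fsupp le_nm P by rewrite inE imset_f.
have r0 : rows P != set0 by apply/set0Pn; exists a.
have := card_fsupp le_nm P; rewrite -cdim1_nonempty // (cardsD1 (w a)) waP add1n -/(f P) fP.
by rewrite (eqP cardD) => -[e]; apply/eqP.
Qed.

(** The hockey-stick identity, which collects the excluded subsets for all top rows into the single
    subtracted binomial coefficient. *)
Lemma sum_bin_ord k N : (\sum_(a < N) 'C(a, k) = 'C(N, k.+1))%N.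
Proof.
elim: N => [|N IHN]; first by rewrite big_ord0 bin0n.
by rewrite big_ord_recr /= IHN binS addnC.
Qed.

Lemma card_cells k : (#|cells X k|)%:Z =
  \sum_(a < n) ('C(lam a - 1, k.+1))%:Z - ('C(n, k.+2))%:Z.
Proof.
have PoszS (F : 'I_n -> nat) : (\sum_a F a)%N%:Z = \sum_a (F a)%:Z.
  exact: (big_morph Posz PoszD (erefl _)).
rewrite cells_top_row -sum_bin_ord !PoszS -sumrB; apply: eq_bigr => a _.
by rewrite card_top_row subzn // leq_bin2l // -ltnS subn1 (ltn_predK (lam_gt a)).
Qed.

End Counting.

(** * Regrading, and passing from an ideal to its quotient *)

Section Regrading.
Variables (K : fieldType) (m : nat).
Local Notation S := {mpoly K[m]}.

Lemma eq_min_graded_resolution (A : zmodType) (gr : 'X_{1..m} -> A) (J J' I : {pred S}) F :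
  J =i J' -> min_graded_resolution gr J I F -> min_graded_resolution gr J' I F.
Proof.
move=> JJ' [gF [res1 res2 res3] mF]; split=> //; split=> // f.
by rewrite -JJ'.
Qed.

Definition regrade (A B : zmodType) (phi : A -> B) (F : free_complex K m A) :
    free_complex K m B :=
  @FreeComplex K m B (rank F) (fun i a => phi (shift a)) (diff F) (aug F).

Lemma regrade_resolution (A B : zmodType) (phi : {additive A -> B})
    (gr : 'X_{1..m} -> A) (gr' : 'X_{1..m} -> B) (J I : {pred S}) F :
    (forall u, gr' u = phi (gr u)) -> min_graded_resolution gr J I F ->
  min_graded_resolution gr' J I (regrade phi F).
Proof.
move=> grE [[augF diffF] resF minF]; split=> //; split=> [a u /augF|i a b u /diffF] /= ->.
  by rewrite grE.
by rewrite raddfD grE.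
Qed.

Definition total_degree (v : 'rV[int]_m) : int := \sum_j v 0 j.

Lemma total_degree_is_additive : additive total_degree.
Proof.
by move=> u v; rewrite /total_degree -sumrB; apply: eq_bigr => j _; rewrite !mxE.
Qed.

HB.instance Definition _ :=
  GRing.isAdditive.Build 'rV[int]_m int total_degree total_degree_is_additive.

Lemma total_multidegree u : total_degree (multidegree u) = std_degree u.
Proof.
rewrite /total_degree /std_degree mdegE (big_morph Posz PoszD (erefl _)).
by apply: eq_bigr => j _; rewrite mxE.
Qed.

Variables (F : free_complex K m int) (J : {pred S}).

(** S is put in front and [aug F] becomes the first differential, so position i + 1 here is position
    i of F. *)
Definition quotient_complex : free_complex K m int :=
  let rk i := if i is k.+1 then rank F k else 1%N in
  @FreeComplex K m int rk
    (fun i => if i is k.+1 return 'I_(rk i) -> int then fun a => shift a else fun=> 0)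
    (fun i => if i is k.+1 return 'M[S]_(rk i.+1, rk i) then diff F k else aug F)
    (1%:M : 'M[S]_1).

Lemma quotient_resolution :
    {subset J <= irrelevant_ideal K m} -> is_ideal J ->
    min_graded_resolution (@std_degree m) J (zero_ideal K m) F ->
  min_graded_resolution (@std_degree m) (whole_ring K m) J quotient_complex.
Proof.
move=> Jirr [J0 _ _] [[augF diffF] [res1 res2 res3] minF].
have augJ a : aug F a 0 \in J.
  apply/res1; exists (delta_mx 0 a), 0; rewrite inE eqxx; split=> //.
  by rewrite -rowE mxE addr0.
split; first split.
- move=> a u /=; rewrite (ord1 a) mxE eqxx msupp1 inE => /eqP->.
  by rewrite /std_degree mdeg0.
- case=> [|k] a b u /=; last exact: diffF.
  by rewrite (ord1 b) add0r => /augF.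
- split.
  + move=> f; split=> // _; exists (f%:M), 0; split=> //.
    by rewrite mulmx1 mxE eqxx mulr1n addr0.
  + move=> v; rewrite /= mulmx1; split=> [/res1[u [g [/eqP-> vE]]]|[u ->]].
      by exists u; apply/rowP => i; rewrite (ord1 i) vE addr0.
    by apply/res1; exists u, 0; rewrite inE eqxx addr0.
  + case=> [|k] v /=; last exact: res3.
    rewrite -res2 inE; split=> [->|/eqP v0]; first by rewrite mxE.
    by apply/rowP => i; rewrite (ord1 i) v0 mxE.
- case=> [|k] a b /=; last exact: minF.
  by rewrite (ord1 b); apply: Jirr.
Qed.

End Regrading.

(** * Height and depth of edge ideals *)

Section EdgeIdeal.
Variables (K : fieldType) (m : nat) (e : rel 'I_m).
Hypothesis e_irr : irreflexive e.
Local Notation S := {mpoly K[m]}.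
Local Notation I := (edge_ideal K e).

Lemma is_ideal_edge : is_ideal I. Proof. exact: is_ideal_gen. Qed.

Lemma edgeM i j : e i j -> 'X_i * 'X_j \in I.
Proof. by move=> eij; apply: mem_ideal_gen; exists i, j. Qed.

(** Since there are no loops, the generators are squarefree, and divisibility only asks for two
    nonzero exponents. *)
Lemma edge_idealP f :
  f \in I <-> forall u, u \in msupp f -> exists i j, [/\ e i j, u i != 0%N & u j != 0%N].
Proof.
have PG (g : S) : (exists i j, e i j /\ g = 'X_i * 'X_j) <->
    exists u, (exists i j, e i j /\ u = (U_(i) + U_(j))%MM) /\ g = 'X_[u].
  split=> [[i [j [eij ->]]]|[_ [[i [j [eij ->]]] ->]]].
    by exists (U_(i) + U_(j))%MM; rewrite mpolyXD; split=> //; exists i, j.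
  by exists i, j; rewrite mpolyXD.
rewrite (mem_monomial_ideal _ PG); split=> suppf u /suppf.
  case=> _ [[i [j [eij ->]]] /mnm_lepP le]; exists i, j.
  have := le i; have := le j; rewrite !mnmDE !mnm1E !eqxx -!lt0n.
  by split=> //; [apply: leq_trans (le i) | apply: leq_trans (le j)];
    rewrite mnmDE !mnm1E eqxx ?addn1.
case=> i [j [eij ui uj]]; exists (U_(i) + U_(j))%MM; split; first by exists i, j.
apply/mnm_lepP => k; rewrite mnmDE !mnm1E.
have [<-|_] := eqVneq i k; last by case: (j =P k) => // <-; rewrite lt0n.
by case: (j =P i) => [ji|_]; [rewrite ji e_irr in eij | rewrite lt0n].
Qed.

Lemma degree_part_edge d f : f \in I -> degree_part d f \in I.
Proof. by rewrite !edge_idealP => suppf u /msupp_degree_part[/suppf]. Qed.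

Definition vertex_cover (A : {set 'I_m}) := forall i j, e i j -> (i \in A) || (j \in A).

Lemma edge_sub_var_prime A : vertex_cover A -> {subset I <= @var_prime K m A}.
Proof.
move=> cov; apply: ideal_gen_sub; first exact/prime_is_ideal/prime_var_prime.
move=> _ [i [j [/cov/orP ijA ->]]].
have idA := prime_is_ideal (prime_var_prime K A).
by case: ijA => ?; [apply: is_idealMr | apply: is_idealM]; rewrite ?var_primeX.
Qed.

Lemma var_prime_irr A : {subset @var_prime K m A <= irrelevant_ideal K m}.
Proof.
apply: var_prime_min; first exact: is_ideal_irr.
by move=> i _; apply: mem_ideal_gen; exists i.
Qed.

Lemma edge_sub_irr : {subset I <= irrelevant_ideal K m}.
Proof.
move=> f /(@edge_sub_var_prime [set: 'I_m]) fI; apply/var_prime_irr/fI.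
by move=> i j _; rewrite inE.
Qed.

Lemma irr_not1 : 1 \notin irrelevant_ideal K m.
Proof. by apply/negP => /irr_mcoeff0/eqP; rewrite mcoeff1 eqxx oner_eq0. Qed.

Lemma edge_ideal_height (A Q : {set 'I_m}) n :
    vertex_cover A -> #|A| = n -> (n < #|Q|)%N ->
    {in Q &, forall i j, i != j -> e i j} ->
  ideal_height I n.
Proof.
move=> cov cardA cardQ clique; split.
  exists (@var_prime K m A); split; first exact: prime_var_prime.
    exact: edge_sub_var_prime.
  by rewrite -cardA; apply: prime_height_var.
move=> P h primeP IP hP.
pose B := [set i in Q | 'X_i \in P].
(* Two distinct clique variables outside P would have their product in I, hence in P. *)
have : (#|Q :\: B| <= 1)%N.
  apply/card_le1_eqP => i j; rewrite !inE => /andP[iB iQ] /andP[jB jQ].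
  rewrite iQ /= in iB; rewrite jQ /= in jB.
  apply/eqP; apply: contraT; rewrite eq_sym => ij; have /edgeM/IP := clique _ _ iQ jQ ij.
  by case/(primeM primeP) => h'; [rewrite h' in iB | rewrite h' in jB].
have BQ : B \subset Q by apply/subsetP => i; rewrite inE => /andP[].
rewrite cardsD (setIidPr BQ) leq_subLR addn1 => QB.
apply: leq_trans (prime_height_geq (A := B) primeP _ hP).
  by rewrite -ltnS; apply: leq_trans QB.
by move=> i; rewrite inE => /andP[].
Qed.

Lemma ideal_add_nil (J : {pred S}) : is_ideal J -> ideal_add J [::] =i J.
Proof.
move=> idJ f; apply/idP/idP => [|fJ]; last by apply: mem_ideal_gen; left.
by apply: ideal_gen_sub => // g [].
Qed.

(* Monomials outside I are supported on independent sets, hence survive modulo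
   some vertex cover that misses a vertex; there the sum of the variables is
   nonzero. *)
Lemma edge_sum_regular : (0 < m)%N -> regular_seq I [:: \sum_i 'X_i].
Proof.
move=> m_gt0; split=> [[|//] f _|].
  rewrite /= !ideal_add_nil; try exact: is_ideal_edge.
  move=> sfI; apply/edge_idealP => u uf; apply: contrapT => nouv.
  pose i0 : 'I_m := Ordinal m_gt0.
  have [W Wu [i iW] indep] : exists2 W : {set 'I_m}, (forall i, u i != 0%N -> i \in W) &
      exists2 i, i \in W & forall i j, i \in W -> j \in W -> ~~ e i j.
    have [/existsP[i ui]|/existsPn u0] := boolP [exists i, u i != 0%N].
      exists [set i | u i != 0%N]; first by move=> j; rewrite inE.
      exists i; first by rewrite inE.
      move=> j k; rewrite !inE => uj uk; apply/negP => ejk; apply: nouv.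
      by exists j, k.
    (* For the constant monomial the support is empty; a single vertex serves as a nonempty
       independent set. *)
    exists [set i0]; first by move=> j; rewrite (negPf (u0 j)).
    by exists i0; rewrite ?set11 // => j k /set1P-> /set1P->; rewrite e_irr.
  have cov : vertex_cover (~: W).
    move=> j k ejk; rewrite !inE -negb_and; apply: contraTN ejk => /andP[].
    exact: indep.
  have := edge_sub_var_prime cov sfI; case/(primeM (prime_var_prime K _)).
    move/var_primeP/(_ U_(i)%MM); rewrite mcoeff_msupp raddf_sum (bigD1 i) //=.
    rewrite mcoeffX eqxx big1 => [|j ji]; last by rewrite mcoeffXU (negPf ji).
    rewrite addr0 oner_eq0 => /(_ isT)/existsP[j /andP[]].
    by rewrite inE mnm1E; case: (i =P j) => // <-; rewrite iW.
  move/var_primeP/(_ _ uf)/existsP=> [j /andP[]].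
  by rewrite inE => jW /Wu; rewrite (negPf jW).
apply/negP => h; have := irr_not1; apply/negP; rewrite negbK.
move: (1) h; apply: ideal_gen_sub => [|g]; first exact: is_ideal_irr.
case=> [/edge_sub_irr//|]; rewrite inE => /eqP->.
apply: is_ideal_sum => [|i _]; first exact: is_ideal_irr.
by apply: mem_ideal_gen; exists i.
Qed.

Lemma irr_decomp c f : f \in irrelevant_ideal K m ->
  exists t r, f = 'X_c * t + r /\ r \in @var_prime K m [set~ c].
Proof.
pose J := [pred f : S | `[< exists t r, f = 'X_c * t + r /\ r \in @var_prime K m [set~ c] >]].
have idP := prime_is_ideal (prime_var_prime K [set~ c]).
suff sub : {subset irrelevant_ideal K m <= J} by move/sub/asboolP.
apply: ideal_gen_sub => [|_ [i ->]].
  split=> [|f1 f2 /asboolP[t1 [r1 [-> r1P]]] /asboolP[t2 [r2 [-> r2P]]]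
           |a f1 /asboolP[t1 [r1 [-> r1P]]]]; apply/asboolP.
  - by exists 0, 0; rewrite mulr0 addr0; split=> //; case: idP.
  - exists (t1 + t2), (r1 + r2); split; last exact: is_idealD.
    by rewrite mulrDr addrACA.
  - exists (a * t1), (a * r1); split; last exact: is_idealM.
    by rewrite mulrDr mulrCA.
apply/asboolP; have [->|ic] := eqVneq i c.
  by exists 1, 0; rewrite mulr1 addr0; split=> //; case: idP.
by exists 0, 'X_i; rewrite mulr0 add0r var_primeX !inE.
Qed.

Lemma star_mul c r : (forall j, j != c -> e c j) ->
  r \in @var_prime K m [set~ c] -> 'X_c * r \in I.
Proof.
move=> star rP; pose J := [pred f : S | 'X_c * f \in I].
suff : r \in J by [].
apply: (var_prime_min (A := [set~ c])) rP => [|j jc].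
  have idI := is_ideal_edge.
  split=> [|f g|a f]; rewrite !inE ?mulr0.
  - by case: idI.
  - by rewrite mulrDr; apply: (is_idealD idI).
  - by rewrite mulrCA; apply: (is_idealM idI).
by rewrite inE edgeM // star //; move: jc; rewrite !inE.
Qed.

(* If s0, s1 were regular, write s_k = x_c t_k + r_k with r_k free of x_c-powers.
   As x_c kills every other variable, z = x_c t_0 satisfies s1 z in I + (s0), so
   z = s0 g modulo I.  Modulo the prime of all variables but x_c this forces
   g = 1, hence modulo the cover prime A, which contains x_c, it forces s0 = 0;
   but A annihilates x_d. *)
Lemma edge_depth_leq (A : {set 'I_m}) c d (s : seq S) :
    (forall j, j != c -> e c j) -> vertex_cover A -> c \in A -> d \notin A ->
    {in A, forall i, e i d} ->
    {subset s <= irrelevant_ideal K m} -> regular_seq I s ->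
  (size s <= 1)%N.
Proof.
move=> star cov cA dA Ad; case: s => [|s0 [|s1 s]] // sirr [reg _]; exfalso.
have idI := is_ideal_edge; have primeA := prime_var_prime K A.
have primeC := prime_var_prime K [set~ c].
have idA := prime_is_ideal primeA; have idC := prime_is_ideal primeC.
have covC : vertex_cover [set~ c].
  move=> i j eij; rewrite !inE -negb_and; apply: contraTN eij => /andP[/eqP-> /eqP->].
  by rewrite e_irr.
have reg0 f : s0 * f \in I -> f \in I.
  by have := reg 0%N f isT; rewrite /= !ideal_add_nil.
have XnI i : 'X_i \notin I.
  apply/negP => /edge_idealP/(_ U_(i)%MM); rewrite msuppX inE eqxx => /(_ isT).
  move=> [j [k [ejk]]]; rewrite !mnm1E; case: (i =P j) => // ij; case: (i =P k) => // ik.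
  by rewrite -ij -ik e_irr in ejk.
have [t0 [r0 [s0E r0P]]] : exists t r, s0 = 'X_c * t + r /\ r \in @var_prime K m [set~ c].
  by apply: irr_decomp; apply: sirr; rewrite inE eqxx.
have [t1 [r1 [s1E r1P]]] : exists t r, s1 = 'X_c * t + r /\ r \in @var_prime K m [set~ c].
  by apply: irr_decomp; apply: sirr; rewrite !inE eqxx orbT.
(* Otherwise x_c s0 would lie in I, and regularity of s0 would put x_c in I. *)
have s0C : s0 \notin @var_prime K m [set~ c].
  apply/negP => s0C; have /negP[] := XnI c; apply: reg0.
  by rewrite mulrC star_mul.
pose z := 'X_c * t0.
have zI : z \in ideal_add I [:: s0].
  apply: (reg 1%N) => //=.
  (* The cross terms x_c r1 t0 and x_c r0 t1 lie in I because vertex c is adjacent to all others,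
     leaving a multiple of s0. *)
  have -> : s1 * z = ('X_c * (r1 * t0) - 'X_c * (r0 * t1)) + ('X_c * t1) * s0.
    by rewrite s0E s1E /z; ring.
  have idI0 := is_ideal_gen (fun f : S => f \in I \/ f \in [:: s0]).
  apply: (is_idealD idI0); last first.
    by apply: (is_idealM idI0); apply: mem_ideal_gen; right; rewrite inE.
  apply: mem_ideal_gen; left; apply: (is_idealB idI); apply: (star_mul star).
    exact: (is_idealMr idC).
  exact: (is_idealMr idC).
have [i [g [iI zE]]] : exists i g, i \in I /\ z = i + s0 * g.
  pose J := [pred f : S | `[< exists i g, i \in I /\ f = i + s0 * g >]].
  suff sub : {subset ideal_add I [:: s0] <= J} by move/sub/asboolP: zI.
  apply: ideal_gen_sub => [|f [fI|]]; last first.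
  - rewrite inE => /eqP->; apply/asboolP; exists 0, 1.
    by rewrite mulr1 add0r; split=> //; case: idI.
  - by apply/asboolP; exists f, 0; rewrite mulr0 addr0.
  split=> [|f1 f2 /asboolP[i1 [g1 [i1I ->]]] /asboolP[i2 [g2 [i2I ->]]]
           |a f1 /asboolP[i1 [g1 [i1I ->]]]]; apply/asboolP.
  - by exists 0, 0; rewrite mulr0 addr0; split=> //; case: idI.
  - exists (i1 + i2), (g1 + g2); split; first exact: is_idealD.
    by rewrite mulrDr addrACA.
  - exists (a * i1), (a * g1); split; first exact: is_idealM.
    by rewrite mulrDr mulrCA.
have g1C : 1 - g \in @var_prime K m [set~ c].
  have : s0 * (1 - g) \in @var_prime K m [set~ c].
    have -> : s0 * (1 - g) = i + r0.
      by rewrite mulrBr mulr1 {1}s0E -/z zE; ring.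
    by apply: (is_idealD idC) _ r0P; apply: edge_sub_var_prime iI.
  by case/(primeM primeC) => h; [case/negP: s0C | exact: h].
(* Both primes lie in the irrelevant ideal, which would otherwise contain (1 - g) + g = 1. *)
have gA : g \notin @var_prime K m A.
  apply/negP => gA; have /negP[] := irr_not1.
  rewrite -(subrK g 1); apply: is_idealD; first exact: is_ideal_irr.
    exact: var_prime_irr g1C.
  exact: var_prime_irr gA.
have s0A : s0 \in @var_prime K m A.
  have : s0 * g \in @var_prime K m A.
    have -> : s0 * g = z - i by rewrite zE; ring.
    apply: (is_idealB idA); last exact: edge_sub_var_prime iI.
    by apply: (is_idealMr idA); rewrite var_primeX.
  by case/(primeM primeA) => h; [exact: h | case/negP: gA].
have /negP[] := XnI d; apply: reg0.
suff : s0 \in [pred f : S | f * 'X_d \in I] by [].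
apply: (var_prime_min (A := A)) s0A => [|j jA]; last by rewrite inE edgeM // Ad.
split=> [|f1 f2|a f1]; rewrite !inE ?mul0r.
- by case: idI.
- by rewrite mulrDl; apply: (is_idealD idI).
- by rewrite -mulrA; apply: (is_idealM idI).
Qed.

Lemma edge_ideal_depth (A : {set 'I_m}) c d :
    (forall j, j != c -> e c j) -> vertex_cover A -> c \in A -> d \notin A ->
    {in A, forall i, e i d} ->
  quotient_depth I 1.
Proof.
move=> star cov cA dA Ad; split; last first.
  by move=> s; apply: (edge_depth_leq star cov cA dA Ad).
exists [:: \sum_i 'X_i]; split=> //.
  move=> f; rewrite inE => /eqP->; apply: is_ideal_sum => [|i _]; first exact: is_ideal_irr.
  by apply: mem_ideal_gen; exists i.
by apply: edge_sum_regular; apply: leq_ltn_trans (ltn_ord c).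
Qed.

End EdgeIdeal.

(** * Threshold graphs *)

Section Threshold.
Variables (R : realType) (m : nat) (e : rel 'I_m).
Hypotheses (m_gt0 : (0 < m)%N) (e_sym : ssrbool.symmetric e) (e_irr : irreflexive e).
Hypothesis e_thr : threshold_graph R e.
Hypothesis deg_mono : forall i j : 'I_m, (i <= j)%N -> (degree e j <= degree e i)%N.
Hypothesis deg_ge1 : forall i : 'I_m, (1 <= degree e i)%N.

Let N (x : 'I_m) := [set y | e x y].

(** Vertices are ordered by degree, not by weight. If nevertheless w i < w j, the neighbours of i
    other than j are neighbours of j, and the degree inequality forces equality of the two sets. *)
Lemma threshold_nested (i j k : 'I_m) :
  (i <= j)%N -> k != i -> k != j -> e j k -> e i k.
Proof.
have [w wP] := e_thr => ij ki kj ejk.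
have [le_ji|lt_ij] := leP (w j) (w i).
  rewrite wP 1?eq_sym //; rewrite wP 1?eq_sym // in ejk.
  by apply: lt_le_trans ejk _; rewrite lerD2r.
have sub : N i :\ j \subset N j :\ i.
  apply/subsetP => y; rewrite !inE => /andP[yj eiy].
  have yi : y != i by apply: contraTneq eiy => ->; rewrite e_irr.
  rewrite yi /=; rewrite wP 1?eq_sym //; rewrite wP 1?eq_sym // in eiy.
  by apply: lt_trans eiy _; rewrite ltrD2r.
have : N i :\ j = N j :\ i.
  apply/eqP; rewrite eqEcard sub /=; have := deg_mono ij.
  rewrite /degree (cardsD1 j [set y | e i y]) (cardsD1 i [set y | e j y]) !inE.
  by rewrite (e_sym j i) leq_add2l.
by move/setP/(_ k); rewrite !inE ki kj ejk /= => ->.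
Qed.

Local Notation n := (durfee (graph_lambda e)).

Lemma durfee_gt (i : 'I_m) : (i < degree e i)%N -> (i < n)%N.
Proof.
move=> i_deg.
exact: (@leq_bigmax_cond _ (fun i : 'I_m => i.+1 + 1 <= graph_lambda e i)%N
  (fun i : 'I_m => i.+1) i ltac:(by rewrite /graph_lambda addn1)).
Qed.

Lemma durfee_degree (i : 'I_m) : (i < n)%N -> (n <= degree e i)%N.
Proof.
move=> lt_in.
have [|i0 i0P nE] := @eq_bigmax_cond _
    (fun i : 'I_m => i.+1 + 1 <= graph_lambda e i)%N (fun i : 'I_m => i.+1).
  apply/card_gt0P; apply: contrapT => none.
  suff n0 : n = 0%N by rewrite n0 in lt_in.
  by apply: big1 => j jP; case: none; exists j.
have {}nE : n = i0.+1 by [].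
rewrite nE; move: i0P; rewrite unfold_in /graph_lambda addn1 ltnS => /leq_trans; apply.
by apply: deg_mono; rewrite -ltnS -nE.
Qed.

(** By nestedness the closed neighbourhood of i fills up from the left. If j > i is a neighbour, all
    k <= j except i are, which makes j of them; if j is not, all neighbours lie among the j - 1
    vertices k < j other than i. *)
Lemma edge_ltE (i j : 'I_m) : (i < j)%N -> e i j = (i < n)%N && (j <= degree e i)%N.
Proof.
move=> ij; have ji : j != i by rewrite -val_eqE /= gtn_eqF.
apply/idP/andP => [eij|[i_n j_deg]].
  have j_deg : (j <= degree e i)%N.
    have sub : (j |: [set k : 'I_m | (k < j)%N]) :\ i \subset N i.
      apply/subsetP => k; rewrite !inE => /andP[ki /orP[/eqP->//|kj]].
      by rewrite e_sym (@threshold_nested k j i) ?(ltnW kj) 1?eq_sym // e_sym.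
    apply: leq_trans (subset_leq_card sub).
    have := cardsD1 i (j |: [set k : 'I_m | (k < j)%N]).
    rewrite cardsU1 !inE ltnn ij orbT /= card_ord_lt; last exact/ltnW/ltn_ord.
    by rewrite !add1n => -[<-].
  split=> //; apply: durfee_gt; exact: leq_trans ij j_deg.
apply: contraT => neij.
have sub : N i \subset [set k : 'I_m | (k < j)%N] :\ i.
  apply/subsetP => k; rewrite !inE => eik.
  have ki : k != i by apply: contraTneq eik => ->; rewrite e_irr.
  rewrite ki /= ltnNge; apply: contra neij => jk.
  have [->//|kj] := eqVneq j k.
  by rewrite e_sym (@threshold_nested j k i) 1?eq_sym // e_sym.
have := leq_trans j_deg (subset_leq_card sub).
have := cardsD1 i [set k : 'I_m | (k < j)%N]; rewrite inE ij card_ord_lt; last first.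
  exact/ltnW/ltn_ord.
by move=> {1}->; rewrite add1n ltnn.
Qed.

Lemma durfee_gt0 : (0 < n)%N.
Proof. exact: (@durfee_gt (Ordinal m_gt0) (deg_ge1 _)). Qed.

Lemma degree_lt (i : 'I_m) : (degree e i < m)%N.
Proof.
have : N i \subset [set~ i] by apply/subsetP => k; rewrite !inE; apply: contraTneq => ->; rewrite e_irr.
move/subset_leq_card; rewrite cardsC1 card_ord => le; apply: leq_ltn_trans le _.
by rewrite ltn_predL.
Qed.

Lemma durfee_lt : (n < m)%N.
Proof.
have := durfee_gt0 => /(@durfee_degree (Ordinal m_gt0))/leq_ltn_trans; apply.
exact: degree_lt.
Qed.

(** The last vertex has a neighbour, so by nestedness vertex 0 is adjacent to it. The edge criterion
    then gives vertex 0 degree at least m - 1. *)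
Lemma first_dominating (j : 'I_m) : j != Ordinal m_gt0 -> e (Ordinal m_gt0) j.
Proof.
set o := Ordinal m_gt0 => jo.
have o_lt (k : 'I_m) : k != o -> (o < k)%N.
  by rewrite -val_eqE /= lt0n.
have lt_pm : (m.-1 < m)%N by rewrite ltn_predL.
pose l : 'I_m := Ordinal lt_pm.
have lo : l != o.
  have := o_lt _ jo; rewrite -val_eqE /= -lt0n => j_gt0; apply: leq_trans j_gt0 _.
  by rewrite -ltnS prednK.
rewrite edge_ltE ?o_lt // durfee_gt0 /=; apply: (@leq_trans l).
  by rewrite /= -ltnS prednK.
have /card_gt0P[k] := deg_ge1 l; rewrite inE => elk.
have kl : k != l by apply: contraTneq elk => ->; rewrite e_irr.
have : e o l.
  have [<-|ko] := eqVneq k o; first by rewrite e_sym.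
  by apply: (@threshold_nested o k l) => //; rewrite 1?eq_sym // e_sym.
by rewrite edge_ltE ?o_lt // => /andP[].
Qed.

End Threshold.

Theorem corollary4p6 (R : realType) (K : fieldType) (m : nat) (e : rel 'I_m)
    (m_gt0 : (0 < m)%N) (e_sym : ssrbool.symmetric e) (e_irr : irreflexive e)
    (e_thr : threshold_graph R e)
    (deg_mono : forall i j : 'I_m, (i <= j)%N -> (degree e j <= degree e i)%N)
    (deg_ge1 : forall i : 'I_m, (1 <= degree e i)%N) :
  let n := durfee (graph_lambda e) in
  let le_nm : (n <= m)%N := durfee_leq (graph_lambda e) in
  let lam : 'I_n -> nat := fun i => graph_lambda e (widen_ord le_nm i) in
  let mu : 'I_n -> nat := fun i => i.+1 in
  let X := gferrers_complex K m lam mu in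
  let I := edge_ideal K e in
  ((0 < n)%N /\ ferrers_shape m lam mu) /\
  I =i spec_gferrers_ideal K le_nm lam mu /\
  ((exists eps : face X -> face X -> int, incidence_function eps) /\
   (forall eps : face X -> face X -> int, incidence_function eps ->
      min_graded_resolution (@multidegree m) I (zero_ideal K m)
        (cellular_complex K (spec_label K le_nm lam mu) eps))) /\
  ideal_regularity I 2 /\
  ideal_height I n /\
  quotient_depth I 1 /\
  (forall i : nat, (0 < i)%N ->
     exists2 b : nat, quotient_betti I i b &
       b%:Z = \sum_(a < n) ('C(lam a - 1, i))%:Z - ('C(n, i.+1))%:Z).
Proof.
move=> n le_nm lam mu X I.
have lamE i : lam i = (degree e (widen_ord le_nm i)).+1 by [].
have n_gt0 : (0 < n)%N := durfee_gt0 m_gt0 deg_ge1.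
have n_lt : (n < m)%N := durfee_lt m_gt0 e_irr deg_mono deg_ge1.
have lam_mono (i j : 'I_n) : (i <= j)%N -> (lam j <= lam i)%N.
  by move=> ij; rewrite !lamE ltnS; apply: deg_mono.
have lam_le i : (lam i <= m)%N by rewrite lamE; apply: degree_lt.
have n_lam (i : 'I_n) : (n < lam i)%N.
  by rewrite lamE ltnS; apply: (durfee_degree deg_mono); apply: (ltn_ord i).
have lam_gt (i : 'I_n) : (i < lam i)%N by apply: ltn_trans (ltn_ord i) (n_lam i).
have edgeE := edge_ltE e_sym e_irr e_thr deg_mono.
have IE : I =i spec_gferrers_ideal K le_nm lam mu.
  apply: eq_ideal_gen => f; split=> [[i [j [eij ->]]]|[i [j [ij ->]]]].
    wlog ij : i j eij / (i < j)%N => [hw|].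
      have [||ij] := ltngtP i j; first exact: hw.
        by move=> ji; rewrite mulrC; apply: hw; rewrite // e_sym.
      by move: eij; rewrite (val_inj ij) e_irr.
    have := eij; rewrite edgeE // => /andP[i_n j_deg].
    exists (Ordinal i_n), j; split; last by congr ('X_(_) * _); apply: val_inj.
    rewrite /in_shape /mu /= ltnS ij lamE ltnS (leq_trans j_deg) //.
    by rewrite (_ : widen_ord _ _ = i) //; apply: val_inj.
  exists (widen_ord le_nm i), j; split=> //.
  by move/andP: ij => [ij j_lam]; rewrite edgeE //; apply/andP; split; [apply: (ltn_ord i) | rewrite -ltnS].
have res eps : incidence_function eps ->
    min_graded_resolution (@multidegree m) I (zero_ideal K m)
      (cellular_complex K (spec_label K le_nm lam mu) eps).
  move=> incP; apply: eq_min_graded_resolution (cellular_resolution le_nm lam_mono incP).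
  by move=> f; rewrite IE.
have inc_sign := @face_sign_incidence K n m le_nm lam.
pose F0 := cellular_complex K (spec_label K le_nm lam mu) (@face_sign K n m le_nm lam).
pose F := regrade (@total_degree m) F0.
have resF : min_graded_resolution (@std_degree m) I (zero_ideal K m) F.
  by apply: regrade_resolution (res _ inc_sign) => u; apply/esym/total_multidegree.
have idI : is_ideal I := is_ideal_edge K e.
have id0 : is_ideal (zero_ideal K m).
  split=> [|f g|a f]; rewrite !inE //; first by move=> /eqP-> /eqP->; rewrite addr0.
  by move=> /eqP->; rewrite mulr0.
have h0 d f : f \in zero_ideal K m -> degree_part d f \in zero_ideal K m.
  by rewrite !inE => /eqP->; rewrite degree_part0.
(* Cells in position i have dimension i, hence i + 2 elements in their support, which is the degree
   of their label. *)
have shiftF i (a : 'I_(rank F i)) : shift a - i%:Z = 2.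
  rewrite /= face_labelE total_multidegree /std_degree mdeg_mesym1 card_fsupp.
  have := enum_valP a; rewrite inE => /eqP dimP.
  rewrite -cdim1_nonempty -?cdim1_eq0 dimP //.
  by rewrite -addn2 addnC PoszD addrK.
pose c : 'I_m := Ordinal m_gt0; pose d : 'I_m := Ordinal n_lt.
pose A := [set i : 'I_m | (i < n)%N].
have cov : vertex_cover e A.
  move=> i j; rewrite !inE; have [ij|ji|/val_inj ->] := ltngtP i j.
  - by rewrite edgeE // => /andP[->].
  - by rewrite e_sym edgeE // => /andP[->]; rewrite orbT.
  - by rewrite e_irr.
have cardA : #|A| = n by apply: card_ord_lt; apply: ltnW.
have edge_clique (i j : 'I_m) : (i < j)%N -> (j <= n)%N -> e i j.
  move=> ij jn; have i_n := leq_trans ij jn; rewrite edgeE // i_n /=.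
  exact: leq_trans jn (durfee_degree deg_mono i_n).
split.
  split=> //; split=> // i j.
  by apply: leq_ltn_trans (n_lam j); apply: (ltn_ord i).
split=> //; split; first by split=> //; exists (@face_sign K n m le_nm lam).
split.
  split; first by exists F.
  move=> G resG; split=> [|i a]; last first.
    by have [b ->] := min_resolution_shift id0 h0 a resG resF; rewrite shiftF.
  (* Attaining the regularity requires a generator. The vertex with row 0 and column n exists
     because n < lam 0, and its shift has a counterpart in G. *)
  have c0 : (0 < rank F 0)%N.
    pose i0 := Ordinal n_gt0.
    have [|||rP cP] := @gfaceP K n m lam [set i0] [set d].
    - by apply/set0Pn; exists i0; rewrite set11.
    - by apply/set0Pn; exists d; rewrite set11.
    - by move=> a b /set1P-> /set1P->; rewrite /= n_gt0 n_lam.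
    apply/card_gt0P; exists (gface K lam [set i0] [set d]).
    by rewrite inE cdim1E rP cP !cards1.
  have [b _] := min_resolution_shift id0 h0 (Ordinal c0) resF resG.
  exists 0%N, b; have [a ->] := min_resolution_shift id0 h0 b resG resF.
  exact: shiftF.
split.
  apply: (@edge_ideal_height K m e A [set i : 'I_m | (i < n.+1)%N] n) => //.
    by rewrite card_ord_lt.
  move=> i j; rewrite !inE !ltnS => i_n j_n.
  rewrite -val_eqE neq_ltn => /orP[ij|ji]; first exact: edge_clique.
  by rewrite e_sym edge_clique.
split.
  (* Vertex c = 0 dominates the graph; vertex d = n lies outside the cover A and completes it to a
     clique, so it is adjacent to all of A. *)
  apply: (@edge_ideal_depth K m e e_irr A c d) => //; rewrite ?inE ?ltnn //.
  - move=> j jc; exact: (first_dominating e_sym e_irr e_thr deg_mono deg_ge1 jc).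
  - by move=> i; rewrite inE => i_n; apply: edge_clique.
(* Cells of dimension i sit in position i + 1 of the resolution of S / I. *)
case=> [//|i] _; exists #|cells X i|; last exact: card_cells.
have resQ := quotient_resolution (@edge_sub_irr K m e) idI resF.
split; first by exists (quotient_complex F).
move=> G resG; apply: etrans (min_resolution_rank idI _ i.+1 resG resQ) _ => //.
by move=> k f; apply: degree_part_edge.
Qed.
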